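(* Let $\mathcal{T}$ be an infinite, locally finite, rooted tree with root $\varrho$, and let $M\in\mathbb{N}=\{0,1,2,\dots\}$, $\lambda>0$. Let $\mathbf{X}$ be the $M$-digging random walk with bias $\lambda$ ($M$-DRW$_\lambda$) on $\mathcal{T}$ with parameters $\lambda$ and $\overline{M}=(m_\nu;\nu\in V)$ such that $m_\varrho=0$ and $m_\nu=M$ for all $\nu\in V\setminus\{\varrho\}$. Then: (1) in the case $\lambda=1$, if $br_r(\mathcal{T})<M+1$ then $\mathbf{X}$ is recurrent, and if $br_r(\mathcal{T})>M+1$ then $\mathbf{X}$ is transient; (2) for any $\lambda>1$, if $br(\mathcal{T})<\lambda^{M+1}$ then $\mathbf{X}$ is recurrent, and if $br(\mathcal{T})>\lambda^{M+1}$ then $\mathbf{X}$ is transient; (3) for any $\lambda<1$, $\mathbf{X}$ is transient.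
   Context: Tree notation: $\mathcal{T}=(V,E)$ has root $\varrho$; $|\nu|$ is the graph distance from $\nu\in V$ to $\varrho$; each edge $e$ has endpoints $e^-,e^+$ with $|e^+|=|e^-|+1$, and $|e|:=|e^+|$. A cutset is a set $\pi$ of edges such that every infinite self-avoiding path $(\nu_i)_{i\ge 0}$ started at $\varrho$ has exactly one $i\ge1$ with $[\nu_{i-1},\nu_i]\in\pi$; $\Pi$ is the set of cutsets. The branching number and branching-ruin number are $$br(\mathcal{T})=\sup\Big\{\gamma>0:\inf_{\pi\in\Pi}\sum_{e\in\pi}\gamma^{-|e|}>0\Big\}\in[1,\infty],\qquad br_r(\mathcal{T})=\sup\Big\{\gamma>0:\inf_{\pi\in\Pi}\sum_{e\in\pi}|e|^{-\gamma}>0\Big\}\in[0,\infty].$$ $M$-DRW$_\lambda$: given $\lambda>0$ and non-negative integers $(m_\nu)_{\nu\in V}$ with $m_\varrho=0$, the walk $\mathbf{X}=(X_n)_{n\ge0}$ starts at $X_0=\varrho$. Let $\ell_n(\nu)=|\{k\in\{0,\dots,n\}:X_k=\nu\}|$ and $$W_n(e)=\big(1-\mathbf{1}_{\{\ell_n(e^-)\le m_{e^-}\}}\big)\lambda^{-|e|+1}.$$ On $\{X_n=\nu\}$, for $\mu\sim\nu$, $$\mathbb{P}(X_{n+1}=\mu\mid X_0,\dots,X_n)=\frac{W_n([\nu,\mu])}{\sum_{\mu'\sim\nu}W_n([\nu,\mu'])}.$$ Recurrence/transience: let $\sigma_0=0$, $\sigma_{n+1}=\inf\{k>\sigma_n: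 X_k\ne X_{\sigma_n},\ \ell_k(X_k)\ge m_{X_k}+1\}$, $\widetilde X_n=X_{\sigma_n}$, and $T(\varrho)=\inf\{k\ge1:\widetilde X_k=\varrho\}$. The walk $\mathbf{X}$ is transient if $\mathbb{P}(T(\varrho)=\infty)>0$, and recurrent otherwise. *)

(* Defs.v *)
From HB Require Import structures.
From mathcomp Require Import all_boot all_order all_algebra.
From mathcomp Require Import all_classical all_reals all_analysis.
Set Implicit Arguments.
Unset Strict Implicit.
Unset Printing Implicit Defensive.
Import Order.TTheory GRing.Theory Num.Theory.
Local Open Scope classical_set_scope.
Local Open Scope ring_scope.

Record rootedTree := RootedTree {
  vertex :> choiceType;
  adj : rel vertex;
  root_vertex : vertex;
  adj_sym : symmetric adj;
  adj_irr : irreflexive adj;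
  adj_connected : forall x y : vertex, exists2 p, path adj x p & last x p = y;
  adj_acyclic : forall c : seq vertex, (2 < size c)%N -> ~ ucycle adj c }.

Section Tree.
Variable T : rootedTree.

Definition infinite_tree := infinite_set [set: T].

Definition locally_finite := forall v : T, finite_set [set w : T | adj v w].

Definition joined_in (x y : T) (n : nat) :=
  exists p, [/\ path (@adj T) x p, last x p = y & size p = n].

Lemma ex_joined_in (x y : T) : exists n, `[< joined_in x y n >].
Proof.
by have [p xp py] := adj_connected x y; exists (size p); apply/asboolP; exists p.
Qed.

Definition dist (x y : T) : nat := ex_minn (ex_joined_in x y).

Definition depth (v : T) : nat := dist v (root_vertex T).

(* The (undirected) edge e is encoded by the ordered pair (e^-, e^+), which
   is unique because adjacent vertices of a tree have depths differing by 1. *)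
Definition edges : set (T * T) :=
  [set e | adj e.1 e.2 /\ depth e.2 = (depth e.1).+1].

Definition edge (v w : T) : T * T :=
  if (depth v < depth w)%N then (v, w) else (w, v).

Definition edge_depth (e : T * T) : nat := depth e.2.

Definition infinite_path (r : nat -> T) :=
  [/\ r 0%N = root_vertex T, injective r & forall i, adj (r i) (r i.+1)].

Definition cutset (pi : set (T * T)) :=
  pi `<=` edges /\
  forall r, infinite_path r ->
    exists! i, (1 <= i)%N /\ pi (edge (r i.-1) (r i)).

Section BranchingNumbers.
Variable R : realType.
Local Open Scope ereal_scope.

Definition br : \bar R :=
  ereal_sup [set g%:E | g in [set g : R | (0 < g)%R /\
    0 < ereal_inf [set \esum_(e in pi) (g ^- edge_depth e)%:E
                  | pi in cutset]]].

(* The maximum with 0 implements the convention sup {} = 0: unlike for br, the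
   set of admissible exponents may be empty (e.g. for a single ray). *)
Definition br_r : \bar R :=
  maxe 0 (ereal_sup [set g%:E | g in [set g : R | (0 < g)%R /\
    0 < ereal_inf [set \esum_(e in pi) ((edge_depth e)%:R `^ (- g))%:E
                  | pi in cutset]]]).

End BranchingNumbers.

(* Functionals of a deterministic trajectory x : nat -> T. *)
Definition local_time (x : nat -> T) (n : nat) (v : T) : nat :=
  #|[pred k : 'I_n.+1 | x k == v]|.

Definition weight (R : realType) (lam : R) (m : T -> nat) (x : nat -> T)
    (n : nat) (e : T * T) : R :=
  (1 - (local_time x n e.1 <= m e.1)%N%:R) * lam ^ (- (edge_depth e)%:Z + 1).

(* The infimum of a set of times, None standing for infinity. *)
Definition first_time (Q : pred nat) : option nat :=
  if pselect (exists k, Q k) is left exQ then Some (ex_minn exQ) else None.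

Fixpoint sigma (m : T -> nat) (x : nat -> T) (n : nat) : option nat :=
  if n is n'.+1 then
    if sigma m x n' is Some s then
      first_time (fun k => [&& (s < k)%N, x k != x s
                             & (m (x k) + 1 <= local_time x k (x k))%N])
    else None
  else Some 0%N.

(* None when sigma_n is infinite. *)
Definition Xtilde (m : T -> nat) (x : nat -> T) (n : nat) : option T :=
  omap x (sigma m x n).

Definition return_time (m : T -> nat) (x : nat -> T) : option nat :=
  first_time (fun k => (1 <= k)%N && (Xtilde m x k == Some (root_vertex T))).

Section DiggingWalk.
Context (R : realType) (d : measure_display) (Om : measurableType d).
Variable P : probability Om R.

Definition cond_prob (A B : set Om) : R := fine (P (A `&` B)) / fine (P B).

(* Vertices carry the discrete sigma-algebra. As a connected locally finite
   graph is countable, conditioning on (X_0, ..., X_n) is the elementary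
   conditioning on each history of positive probability. *)
Definition digging_walk (lam : R) (m : T -> nat) (X : nat -> Om -> T) :=
  [/\ forall n (A : set T), measurable (X n @^-1` A),
      P [set w | X 0%N w = root_vertex T] = 1%E
    & forall (n : nat) (x : nat -> T) (v : T),
        let past := [set w | forall k, (k <= n)%N -> X k w = x k] in
        P past != 0%E -> adj (x n) v ->
        cond_prob [set w | X n.+1 w = v] past =
          weight lam m x n (edge (x n) v) /
          \sum_(u \in [set u : T | adj (x n) u])
             weight lam m x n (edge (x n) u)].

Definition transient (m : T -> nat) (X : nat -> Om -> T) :=
  (0 < P [set w | return_time m (X ^~ w) = None])%E.

Definition recurrent (m : T -> nat) (X : nat -> Om -> T) := ~ transient m X.

End DiggingWalk.

Definition constant_digging (M : nat) (v : T) : nat :=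
  if v == root_vertex T then 0%N else M.

End Tree.

Arguments br T R : clear implicits.
Arguments br_r T R : clear implicits.
Arguments infinite_tree T : clear implicits.
Arguments locally_finite T : clear implicits.
Arguments constant_digging T M v : clear implicits.

(* Main.v *)
Require Import Defs.
From mathcomp Require Import all_boot all_order all_algebra.
From mathcomp Require Import all_classical all_reals all_analysis.
From mathcomp Require Import zify ring lra.
Import Order.TTheory GRing.Theory Num.Theory.
Local Open Scope classical_set_scope.
Local Open Scope ring_scope.
Set Implicit Arguments.
Unset Strict Implicit.
Unset Printing Implicit Defensive.

(** The walk is studied through functions of its finite histories (lists of
visited vertices, latest first), on which one step of the walk acts as an
averaging operator [kernel].

Let [R_n = 1 + lam + ... + lam ^ (n - 1)] be the resistance between the root
and depth [n]. If [rho] vanishes at the root and is harmonic for the biased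
walk, then [rho (position) * \prod_w (rho w / rho (par w)) ^ min (visits w, M)]
is a martingale of the digging walk ([kernel_dig_value]): a visit to a vertex
that is not yet dug is cancelled by a forced step back to the parent, and the
gain [rho w / rho (par w)] that the position loses in this way is recorded in
the product. All estimates come from this family of martingales.

Recurrence. Take for [rho] the potential of the path to [v], that is [R] of the
depth at which the paths to [x] and to [v] separate. The martingale gives
probability at most [R_n ^ -(M + 1)], with [n] the depth of [v], for [v] to be
dug before the return ([reach_bound]). By König's lemma a cutset leaves the
root in a finite component, where the walk cannot stay forever without
returning ([dwell_small]). So the survival probability is at most the sum of
[R_n ^ -(M + 1)] over any cutset, and below the critical value these sums have
infimum zero.

Transience. The potential of two paths to [u] and [v] that separate at depth
[m] is the sum of the two potentials, hence harmonic again; its martingale,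
multiplied by [4 ^ M * R_m ^ (M + 1)], dominates the product of the martingales
of [u] and of [v] ([dig_value_pair]). This is quasi-independence, and it allows
a second moment argument. For weights [theta] on a level of the tree, let [G] be
the [theta]-average of the martingales of single paths and [H >= G ^ 2] the
[theta]-average of the dominating martingales of pairs. Then [2 a G - a ^ 2 H]
is a submartingale bounded by the indicator of survival, and for a suitable [a]
its initial value is positive uniformly in the level as soon as the energy
[\sum_(u, v) theta u theta v R_m ^ (M + 1)] is bounded ([alive_prob_ge]). A
maximal flow below the capacities [c n] at depth [n], with
[c n = n ^ -gamma] or [c n = gamma ^ -n], keeps its mass bounded below when the
cutset sums are, and its energy is at most the total mass times
[\sum_n (R_n ^ (M + 1) - R_(n - 1) ^ (M + 1)) c n], which is finite above the
critical value. When [lam < 1] the resistances are bounded and a point mass at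
any vertex of the level has bounded energy. *)

(** * Rooted trees: parents, ancestors, meeting depth *)

Section TreeStructure.
Variable T : rootedTree.
Notation root := (root_vertex T).

Lemma depth_root : depth root = 0%N.
Proof.
rewrite /depth /dist; case: ex_minnP => m _ /(_ 0%N) H.
by apply/eqP; rewrite -leqn0; apply: H; apply/asboolP; exists [::].
Qed.

Lemma depth0_root (v : T) : depth v = 0%N -> v = root.
Proof.
rewrite /depth /dist; case: ex_minnP => m /asboolP[p [_ <- sp]] _ m0.
by move: sp; rewrite m0 => /size0nil ->.
Qed.

Lemma depth_eq0 (v : T) : (depth v == 0%N) = (v == root).
Proof.
by apply/eqP/eqP => [/depth0_root//|->]; exact: depth_root.
Qed.

Lemma depth_gt0 (v : T) : (0 < depth v)%N = (v != root).
Proof. by rewrite lt0n depth_eq0. Qed.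

Lemma depth_adj (v w : T) : adj v w -> (depth v <= (depth w).+1)%N.
Proof.
move=> vw; rewrite /depth /dist; case: ex_minnP => m _; apply.
case: ex_minnP => n /asboolP[p [wp lp sp]] _.
by apply/asboolP; exists (w :: p); rewrite /= vw wp sp.
Qed.

Lemma ex_closer_neighbour (v : T) : v != root ->
  exists2 w, adj v w & (depth w).+1 = depth v.
Proof.
move=> v0; have : exists p, [/\ path (@adj T) v p, last v p = root & size p = depth v].
  by rewrite /depth /dist; case: ex_minnP => m /asboolP.
case=> -[|w p] [/=].
  by move=> _ vr; rewrite vr eqxx in v0.
move=> /andP[vw wp] lp sp; exists w => //; apply/eqP; rewrite eqn_leq.
rewrite (depth_adj vw) andbT -sp ltnS.
rewrite {1}/depth /dist; case: ex_minnP => m _; apply.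
by apply/asboolP; exists p.
Qed.

(** Depths strictly decrease along a shortest path to the root, so such a path
from a vertex that is not deeper than [v] cannot meet [v] again. *)
Lemma path_to_root_avoiding (v w : T) : (depth w <= depth v)%N -> w != v ->
  exists p, [/\ path (@adj T) w p, last w p = root & v \notin w :: p].
Proof.
elim: {w}(depth w) {-2}w (erefl (depth w)) => [|n IHn] w dw wv nv.
  have -> : w = root by apply: depth0_root.
  have wr : w = root by apply: depth0_root.
  by exists [::]; split; rewrite // inE -wr eq_sym.
have [|u wu du] := @ex_closer_neighbour w; first by rewrite -depth_gt0 dw.
have dun : depth u = n by lia.
have [||p [up lp vp]] := IHn u dun; first by lia.
  by apply: contraL wv => /eqP uv; rewrite uv in dun; lia.
exists (u :: p); split => //=; first by rewrite wu.
by rewrite inE negb_or eq_sym nv.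
Qed.

(** Two distinct neighbours of [v] that are not deeper than [v] would be joined
by a walk through the root avoiding [v], hence close up to a cycle. *)
Lemma shallow_neighbour_unique (v w1 w2 : T) : adj v w1 -> adj v w2 ->
  (depth w1 <= depth v)%N -> (depth w2 <= depth v)%N -> w1 = w2.
Proof.
move=> a1 a2 d1 d2; apply/eqP; apply/negPn/negP => w12.
have neq w : adj v w -> w != v.
  by move=> a; apply: contraL a => /eqP ->; rewrite adj_irr.
have [p1 [wp1 l1 v1]] := path_to_root_avoiding d1 (neq _ a1).
have [p2 [wp2 l2 v2]] := path_to_root_avoiding d2 (neq _ a2).
have wp2' : path (@adj T) root (rev (belast w2 p2)).
  rewrite -l2 rev_path (eq_path (e' := @adj T)) // => x y /=.
  by rewrite adj_sym.
pose p := p1 ++ rev (belast w2 p2).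
have pp : path (@adj T) w1 p by rewrite cat_path wp1 l1.
have lp : last w1 p = w2.
  rewrite last_cat l1; case: (p2) l2 => [|u p3] /= l2; first by rewrite l2.
  by rewrite rev_cons last_rcons.
have vp : v \notin w1 :: p.
  rewrite -cat_cons mem_cat negb_or v1 mem_rev.
  by apply: contra v2 => /mem_belast.
move: lp; case: (shortenP pp) => p' pp' up' sp' lp2.
have vp' : v \notin w1 :: p'.
  apply: contra vp; rewrite !inE => /orP[->//|/sp' ->]; exact: orbT.
apply: (@adj_acyclic T (v :: w1 :: p')).
  case: p' lp2 {pp' up' sp' vp'} => [/= e|//].
  by rewrite e eqxx in w12.
rewrite /ucycle /= rcons_path a1 pp' lp2 /=.
by rewrite (adj_sym w2 v) a2 /= vp' /= in up' *.
Qed.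

Definition par (v : T) : T :=
  xget root [set w | adj v w /\ (depth w).+1 = depth v].

Lemma par_root : par root = root.
Proof.
by rewrite /par; case: xgetP => // w _ [_]; rewrite depth_root.
Qed.

Lemma parP (v : T) : v != root -> adj v (par v) /\ (depth (par v)).+1 = depth v.
Proof.
move=> v0; rewrite /par; case: xgetP => [w _ []//|no].
by have [w vw dw] := ex_closer_neighbour v0; case: (no w).
Qed.

Lemma adj_par (v : T) : v != root -> adj v (par v).
Proof. by move=> /parP[]. Qed.

Lemma depth_par (v : T) : depth (par v) = (depth v).-1.
Proof.
have [->|/parP[_ <-]//] := eqVneq v root.
by rewrite par_root depth_root.
Qed.

Lemma shallow_neighbour_par (v w : T) : v != root -> adj v w -> (depth w <= depth v)%N ->
  w = par v.
Proof.
move=> v0 vw dw; have [vp dp] := parP v0.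
by apply: shallow_neighbour_unique vw vp dw _; rewrite -dp.
Qed.

Lemma deeper_neighbour_par (v w : T) : adj v w -> (depth v < depth w)%N -> v = par w.
Proof.
move=> vw d; apply: shallow_neighbour_par; last exact: ltnW.
  by rewrite -depth_gt0; apply: leq_ltn_trans d.
by rewrite adj_sym.
Qed.

Lemma adj_root_depth (w : T) : adj root w -> depth w = 1%N.
Proof.
move=> a; apply/eqP; rewrite eqn_leq.
rewrite adj_sym in a.
have := depth_adj a; rewrite depth_root => -> /=.
rewrite depth_gt0; apply: contraL a => /eqP ->; by rewrite adj_irr.
Qed.

Lemma adj_cases (v w : T) : adj v w =
  ((v != root) && (w == par v)) || ((w != root) && (par w == v)).
Proof.
apply/idP/idP; last first.
  move=> /orP[/andP[v0 /eqP ->]|/andP[w0 /eqP <-]]; first exact: adj_par.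
  by rewrite adj_sym; apply: adj_par.
move=> vw; have [d|d] := leqP (depth w) (depth v).
  have v0 : v != root.
    by apply: contraTneq d => e; rewrite e in vw *; rewrite (adj_root_depth vw) depth_root.
  by rewrite v0 (shallow_neighbour_par v0 vw d) eqxx.
have w0 : w != root by rewrite -depth_gt0; apply: leq_ltn_trans d.
by rewrite w0 -(deeper_neighbour_par vw d) eqxx orbT.
Qed.

(** The ancestor at depth [j], or [v] itself when [j] is at least its depth. *)
Definition anc (j : nat) (v : T) : T := iter (depth v - j) par v.

Definition below (w v : T) := anc (depth w) v == w.

Lemma depth_iter_par k (v : T) : depth (iter k par v) = (depth v - k)%N.
Proof. by elim: k => [|k IHk] /=; rewrite ?subn0// depth_par IHk; lia. Qed.

Lemma depth_anc j (v : T) : depth (anc j v) = minn j (depth v).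
Proof. by rewrite /anc depth_iter_par; lia. Qed.

Lemma anc_depth (v : T) : anc (depth v) v = v.
Proof. by rewrite /anc subnn. Qed.

Lemma anc_ge j (v : T) : (depth v <= j)%N -> anc j v = v.
Proof. by rewrite /anc -subn_eq0 => /eqP ->. Qed.

Lemma anc0 (v : T) : anc 0 v = root.
Proof. by apply: depth0_root; rewrite depth_anc min0n. Qed.

Lemma anc_anc i j (v : T) : (i <= j)%N -> anc i (anc j v) = anc i v.
Proof.
move=> ij; rewrite {1}/anc depth_anc /anc -iterD; congr (iter _ _ _); lia.
Qed.

Lemma anc_par j (v : T) : (j < depth v)%N -> anc j (par v) = anc j v.
Proof.
move=> jv; rewrite /anc depth_par.
by rewrite (_ : (depth v - j = ((depth v).-1 - j).+1)%N) ?iterSr //; lia.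
Qed.

Lemma par_anc j (v : T) : (j < depth v)%N -> par (anc j.+1 v) = anc j v.
Proof.
move=> jv; rewrite /anc.
by rewrite (_ : (depth v - j = (depth v - j.+1).+1)%N) ?iterS //; lia.
Qed.

Lemma below_refl (v : T) : below v v.
Proof. by rewrite /below anc_depth. Qed.

Lemma below_root (v : T) : below root v.
Proof. by rewrite /below depth_root anc0. Qed.

Lemma below_depth (w v : T) : below w v -> (depth w <= depth v)%N.
Proof. by move=> /eqP <-; rewrite depth_anc; lia. Qed.

Lemma below_anc j (v : T) : below (anc j v) v.
Proof.
rewrite /below depth_anc; apply/eqP; have [jv|jv] := leqP j (depth v).
  by congr anc; lia.
by rewrite anc_depth anc_ge // ltnW.
Qed.

Lemma below_par (w v : T) : w != v -> below w (par v) = below w v.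
Proof.
move=> wv; rewrite /below; have [d|d] := ltnP (depth w) (depth v).
  by rewrite anc_par.
have /eqP e : depth (par v) == (depth v).-1 by rewrite depth_par.
rewrite !anc_ge ?e; try lia; rewrite [v == w]eq_sym (negbTE wv).
apply/negbTE/eqP => pw; have v0 : v = root.
  by apply: depth0_root; rewrite -pw e in d; lia.
by rewrite v0 par_root in pw wv; rewrite pw eqxx in wv.
Qed.

Lemma below_parW (w v : T) : below w (par v) -> below w v.
Proof.
have [->|wv] := eqVneq w v; first by rewrite below_refl.
by rewrite below_par.
Qed.

Lemma below_trans (u v w : T) : below u v -> below v w -> below u w.
Proof.
move=> uv vw; have := below_depth uv; move: uv vw => /eqP uv /eqP vw d.
by rewrite /below -(@anc_anc _ (depth v)) // vw uv.
Qed.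

Lemma below_par_child (w v : T) : below w v -> below (par w) v.
Proof.
move=> wv; apply: below_trans wv.
have [->|w0] := eqVneq w root; first by rewrite par_root below_refl.
apply: below_parW; exact: below_refl.
Qed.

(** The depth at which the paths from the root to [x] and to [v] separate. *)
Definition meet_depth (x v : T) : nat :=
  \max_(j < (minn (depth x) (depth v)).+1 | anc j x == anc j v) j.

Lemma leq_meet_depth j (x v : T) : (j <= depth x)%N -> (j <= depth v)%N ->
  (j <= meet_depth x v)%N = (anc j x == anc j v).
Proof.
move=> jx jv; apply/idP/idP; last first.
  move=> e; have jm : (j < (minn (depth x) (depth v)).+1)%N by lia.
  by apply: (@leq_bigmax_cond _ _ _ (Ordinal jm)).
rewrite /meet_depth; set b := minn _ _; have z : anc (@ord0 b) x == anc (@ord0 b) v.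
  by rewrite !anc0.
rewrite (bigop.bigmax_eq_arg ord0) //; case: arg_maxnP => //= i /eqP e _ ji.
by rewrite -(@anc_anc _ i) // e anc_anc.
Qed.

Lemma meet_depth_lel (x v : T) : (meet_depth x v <= depth x)%N.
Proof. by apply/bigmax_leqP => i _; have := ltn_ord i; lia. Qed.

Lemma meet_depth_ler (x v : T) : (meet_depth x v <= depth v)%N.
Proof. by apply/bigmax_leqP => i _; have := ltn_ord i; lia. Qed.

Lemma anc_meet (x v : T) : anc (meet_depth x v) x = anc (meet_depth x v) v.
Proof.
by apply/eqP; rewrite -leq_meet_depth ?meet_depth_lel ?meet_depth_ler.
Qed.

Lemma meet_depthC (x v : T) : meet_depth x v = meet_depth v x.
Proof.
by rewrite /meet_depth minnC; apply: eq_bigl => i; rewrite eq_sym.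
Qed.

Lemma meet_depth_root (v : T) : meet_depth root v = 0%N.
Proof. by apply/eqP; rewrite -leqn0 -depth_root meet_depth_lel. Qed.

(** Meeting depths are ultrametric: two paths that follow a third one down to
depth [j] agree down to depth [j]. *)
Lemma meet_depth_ultra (x u v : T) :
  (minn (meet_depth x u) (meet_depth x v) <= meet_depth u v)%N.
Proof.
set j := minn _ _.
have ju : (j <= meet_depth x u)%N by rewrite geq_minl.
have jv : (j <= meet_depth x v)%N by rewrite geq_minr.
have := meet_depth_lel x u; have := meet_depth_ler x u; have := meet_depth_ler x v.
have := meet_depth_lel x v.
move=> h1 h2 h3 h4; rewrite leq_meet_depth; try lia.
move: ju jv; rewrite !leq_meet_depth; try lia.
by move=> /eqP <- /eqP <-.
Qed.

Lemma meet_depth_below (x v : T) : below x v -> meet_depth x v = depth x.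
Proof.
move=> xv; apply/eqP; rewrite eqn_leq meet_depth_lel /= leq_meet_depth //.
  by rewrite anc_depth eq_sym.
exact: below_depth.
Qed.

Lemma meet_depth_Nbelow (x v : T) : ~~ below x v ->
  meet_depth x v = meet_depth (par x) v.
Proof.
move=> nxv; have x0 : x != root by apply: contraNneq nxv => ->; exact: below_root.
have xp : (0 < depth x)%N by rewrite depth_gt0.
apply/eqP; rewrite eqn_leq; apply/andP; split.
  have m1 : (meet_depth x v <= (depth x).-1)%N.
    rewrite -ltnS prednK // ltn_neqAle meet_depth_lel andbT.
    apply: contra nxv => /eqP e; rewrite /below -{1}e -anc_meet e anc_depth.
    by [].
  rewrite leq_meet_depth ?meet_depth_ler ?depth_par //.
  by rewrite anc_par ?anc_meet //; lia.
have := meet_depth_lel (par x) v; rewrite depth_par => h.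
rewrite leq_meet_depth ?meet_depth_ler //; last lia.
by rewrite -anc_par ?anc_meet //; lia.
Qed.

End TreeStructure.

(** * Locally finite trees: levels, rays, cutsets *)

Section LocallyFiniteTree.
Variable T : rootedTree.
Notation root := (root_vertex T).
Hypothesis lfT : locally_finite T.

Definition children (v : T) : seq T :=
  finmap.enum_fset (fset_set [set w | w != root /\ par w = v]).

Lemma mem_children v w : (w \in children v) = (w != root) && (par w == v).
Proof.
rewrite /children in_fset_set ?inE; last first.
  apply: sub_finite_set (lfT v) => x /= [x0 <-].
  by rewrite adj_sym adj_par.
by apply/idP/idP => [/set_mem[-> /eqP]|/andP[x0 /eqP e]] //; apply/mem_set.
Qed.

Lemma children_uniq v : uniq (children v).
Proof. exact: finmap.fset_uniq. Qed.

Lemma depth_children v w : w \in children v -> depth w = (depth v).+1.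
Proof.
by rewrite mem_children => /andP[w0 /eqP <-]; have [_ ->] := parP w0.
Qed.

Lemma par_children v w : w \in children v -> par w = v.
Proof. by rewrite mem_children => /andP[_ /eqP]. Qed.

Lemma children_neq_root v w : w \in children v -> w != root.
Proof. by rewrite mem_children => /andP[]. Qed.

Lemma adj_children v w : adj v w = ((v != root) && (w == par v)) || (w \in children v).
Proof. by rewrite mem_children adj_cases. Qed.

Lemma below_children v w : below v w -> w != v ->
  exists2 y, y \in children v & below y w.
Proof.
move=> vw wv; have d : (depth v < depth w)%N.
  rewrite ltn_neqAle below_depth // andbT; apply: contra wv => /eqP e.
  by move: vw; rewrite /below e anc_depth.
exists (anc (depth v).+1 w); last exact: below_anc.
rewrite mem_children par_anc // (eqP vw) eqxx andbT -depth_gt0 depth_anc; lia.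
Qed.

Fixpoint level n : seq T :=
  if n is n'.+1 then flatten [seq children v | v <- level n'] else [:: root].

Lemma mem_level n v : (v \in level n) = (depth v == n).
Proof.
elim: n v => [|n IHn] v /=; first by rewrite inE depth_eq0.
apply/flatten_mapP/eqP => [[w]|dv].
  by rewrite IHn => /eqP <- /depth_children.
have v0 : v != root by rewrite -depth_gt0 dv.
exists (par v); first by rewrite IHn depth_par dv.
by rewrite mem_children v0 eqxx.
Qed.

Lemma level_uniq n : uniq (level n).
Proof.
elim: n => //= n IHn.
elim: (level n) IHn => //= v s IHs /andP[vs us].
rewrite cat_uniq children_uniq IHs // andbT /=.
apply/hasPn => w /flatten_mapP[u us' wu] /=.
apply: contra vs => /par_children wv.
by rewrite -wv (par_children wu).
Qed.

Lemma finite_level n : finite_set [set v : T | depth v = n].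
Proof.
rewrite (_ : [set _ | _] = [set` level n]); first exact: finite_seq.
by apply/seteqP; split => v /=; rewrite mem_level => /eqP.
Qed.

Lemma finite_ball n : finite_set [set v : T | (depth v <= n)%N].
Proof.
elim: n => [|n IHn].
  by apply: sub_finite_set (finite_level 0) => v /=; rewrite leqn0 => /eqP.
have : finite_set ([set v : T | (depth v <= n)%N] `|` [set v : T | depth v = n.+1]).
  by rewrite finite_setU; split => //; exact: finite_level.
apply: sub_finite_set => v /=; rewrite leq_eqVlt => /orP[/eqP|]; first by right.
by left.
Qed.

Lemma countable_tree : countable [set: T].
Proof.
have -> : [set: T] = \bigcup_n [set v : T | depth v = n].
  by apply/seteqP; split => // v _; exists (depth v).
apply: bigcup_countable => // n _; apply: finite_set_countable.
exact: finite_level.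
Qed.

Lemma level_nonempty n : infinite_tree T -> exists v : T, depth v = n.
Proof.
move=> infT; apply: contrapT => no; apply: infT.
apply: sub_finite_set (finite_ball n) => v _ /=.
rewrite leqNgt; apply/negP => nv; apply: no; exists (anc n v).
by rewrite depth_anc; lia.
Qed.

Lemma root_has_child : infinite_tree T -> (0 < size (children root))%N.
Proof.
move=> infT; have [v dv] := level_nonempty 1 infT.
have : v \in children root.
  rewrite mem_children -depth_gt0 dv /= -depth_eq0 depth_par dv. by [].
by case: (children root).
Qed.

(** An infinite injective path from the root never turns back: going up would
lead to the parent, which the path has just left. *)
Lemma ray_step (r : nat -> T) i : infinite_path r -> depth (r i) = i /\ par (r i.+1) = r i.
Proof.
move=> [r0 ri ra].
suff H : depth (r i) = i /\ depth (r i.+1) = i.+1.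
  case: H => d1 d2; split => //; apply/esym/deeper_neighbour_par => //.
  by rewrite d1 d2.
elim: i => [|i [d1 d2]].
  by rewrite r0 depth_root; split => //; apply: adj_root_depth; rewrite -r0.
split => //.
have := ra i.+1; rewrite adj_cases => /orP[/andP[_ /eqP e]|/andP[n0 /eqP e]].
  have p1 : par (r i.+1) = r i by apply/esym/deeper_neighbour_par; rewrite ?d1 ?d2.
  by rewrite p1 in e; have /eqP := ri _ _ e; rewrite gtn_eqF //.
have := depth_par (r i.+2); rewrite e d2 => h.
by move: n0; rewrite -depth_gt0; lia.
Qed.

Lemma ray_anc (r : nat -> T) i j : infinite_path r -> (i <= j)%N -> anc i (r j) = r i.
Proof.
move=> rr; elim: j => [|j IHj].
  rewrite leqn0 => /eqP ->; rewrite -[X in anc X _](proj1 (ray_step 0 rr)).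
  exact: anc_depth.
rewrite leq_eqVlt => /orP[/eqP ->|ij].
  by rewrite -[X in anc X _](proj1 (ray_step j.+1 rr)) anc_depth.
by rewrite -anc_par ?(proj2 (ray_step j rr)) ?IHj // (proj1 (ray_step j.+1 rr)).
Qed.

Lemma ray_edge (r : nat -> T) i : infinite_path r -> (0 < i)%N ->
  edge (r i.-1) (r i) = (r i.-1, r i).
Proof.
by move=> rr i0; rewrite /edge !(proj1 (ray_step _ rr)) prednK // leqnn.
Qed.

(** König's lemma: among the children of a vertex with infinitely many
descendants in [S], one has infinitely many as well, and following such
children from the root yields a ray. *)
Lemma konig (S : set T) : infinite_set S -> (forall v, S v -> S (par v)) ->
  exists r, infinite_path r /\ forall i, S (r i).
Proof.
move=> infS Spar.
pose inf v := infinite_set (S `&` [set w | below v w]).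
have step v : inf v -> exists y, y \in children v /\ inf y.
  move=> iv; apply: contrapT => no; apply: iv.
  have : finite_set ([set v] `|` \bigcup_(y in [set` children v]) (S `&` [set w | below y w])).
    rewrite finite_setU; split; first exact: finite_set1.
    apply: bigcup_finite; first exact: finite_seq.
    by move=> y /= yv; apply: contrapT => iy; apply: no; exists y.
  apply: sub_finite_set => w [Sw /= vw].
  have [->|wv] := eqVneq w v; first by left.
  by have [y yv yw] := below_children vw wv; right; exists y.
have inf0 : inf root.
  rewrite /inf (_ : S `&` _ = S) //; apply/seteqP; split=> [v []//|v Sv].
  by split => //=; exact: below_root.
pose next (u : {v | inf v}) : {v | inf v} :=
  let e := cid (step _ (projT2 u)) in exist inf (projT1 e) (proj2 (projT2 e)).
pose r i := sval (iter i next (exist inf root inf0)).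
have rS i : r i.+1 \in children (r i).
  by rewrite /r iterS; set u := iter i _ _; rewrite /next; case: cid => ? [].
have rd i : depth (r i) = i.
  by elim: i => [|i IHi]; rewrite ?(depth_children (rS _)) ?IHi //= /r /= depth_root.
exists r; split.
  split => //.
    by move=> i j /(congr1 (@depth T)); rewrite !rd.
  by move=> i; rewrite adj_children rS orbT.
move=> i; have infi : inf (r i) by apply: (svalP (iter i next (exist inf root inf0))).
have [x [Sx /= rx]] : (S `&` [set w | below (r i) w]) !=set0.
  by apply/set0P/eqP => e; apply: infi; rewrite e; exact: finite_set0.
rewrite -(eqP rx) /anc; elim: (_ - _)%N => //= n; exact: Spar.
Qed.

(** The component of the root once the edges of [pi] are removed. *)
Definition inside (pi : set (T * T)) : set T :=
  [set v | forall j, (j < depth v)%N -> ~ pi (anc j v, anc j.+1 v)].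

Lemma inside_root pi : inside pi root.
Proof. by move=> j; rewrite depth_root. Qed.

Lemma inside_par pi v : inside pi v -> inside pi (par v).
Proof.
move=> iv j; rewrite depth_par => jv.
rewrite !anc_par; [apply: iv; lia|lia|lia].
Qed.

(** Otherwise the component would contain a ray, and this ray would cross no
edge of the cutset. *)
Lemma cutset_inside_finite pi : cutset pi -> finite_set (inside pi).
Proof.
move=> [_ cut]; apply: contrapT => inf.
have [r [rr rin]] := konig inf (@inside_par pi).
have [i [[i0]]] := cut r rr; rewrite ray_edge // => pii _.
apply: (rin i i.-1); first by rewrite (proj1 (ray_step _ rr)) prednK.
by rewrite prednK // !ray_anc // ?leq_pred.
Qed.

Lemma inside_exit pi v : v != root -> inside pi (par v) -> ~ inside pi v -> pi (par v, v).
Proof.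
move=> v0 ip niv; apply: contrapT => npi; apply: niv => j jv.
have [jd|jd] := ltnP j.+1 (depth v).
  by rewrite -(anc_par jd) -(@anc_par _ j) ?(ltnW jd) //; apply: ip; rewrite depth_par; lia.
have -> : j = (depth v).-1 by lia.
by rewrite prednK ?depth_gt0 // -(par_anc (j := (depth v).-1)) ?prednK ?anc_depth ?depth_gt0.
Qed.

End LocallyFiniteTree.

(** * Histories and the transition operator *)

Section Histories.
Variables (R : realType) (T : rootedTree) (lam : R) (M : nat).
Notation root := (root_vertex T).
Hypotheses (lfT : locally_finite T) (infT : infinite_tree T) (lam_gt0 : 0 < lam).

Definition dug (h : seq T) (w : T) := (w == root) || (M < count_mem w h)%N.

(** The extracted walk has left the root: some other vertex has been dug. *)
Definition started (h : seq T) :=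
  has (fun w => (w != root) && (M < count_mem w h)%N) h.

(** The extracted walk has returned to the root. *)
Fixpoint dead (h : seq T) :=
  if h is y :: h' then dead h' || ((y == root) && started h') else false.

(** Conditional expectation of [F] of the next history, given the current one.
A vertex that is not dug yet sends the walk back to its parent. *)
Definition kernel (F : seq T -> R) (h : seq T) : R :=
  let x := head root h in
  if x == root then
    (\sum_(y <- children root) F (y :: h)) / (size (children root))%:R
  else if dug h x then
    (lam * F (par x :: h) + \sum_(y <- children x) F (y :: h))
      / (lam + (size (children x))%:R)
  else F (par x :: h).

Definition step (h : seq T) (y : T) :=
  let x := head root h in
  ((x != root) && (y == par x)) || (dug h x && (y \in children x)).

(** The invariant of histories of positive probability: only dug vertices give
access to their children. *)
Definition supported (h : seq T) :=
  forall w, w \in h -> w != root -> dug h (par w).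

Lemma dug_cons y h w : dug h w -> dug (y :: h) w.
Proof.
rewrite /dug => /orP[->//|Mc]; apply/orP; right => /=.
by rewrite (leq_trans Mc) // leq_addl.
Qed.

Lemma started_cons y h : started h -> started (y :: h).
Proof.
case/hasP => w wh /andP[w0 Mw]; apply/hasP; exists w; first by rewrite inE wh orbT.
by rewrite w0 /= (leq_trans Mw) // leq_addl.
Qed.

Lemma head_mem h : head root h != root -> head root h \in h.
Proof. by case: h => /= [|x h]; rewrite ?eqxx // inE eqxx. Qed.

Lemma supported_head h : supported h -> head root h != root -> dug h (par (head root h)).
Proof. by move=> sh x0; apply: sh => //; exact: head_mem. Qed.

Lemma supported_cons h y : supported h -> step h y -> supported (y :: h).
Proof.
move=> sh /orP[/andP[x0 /eqP yx]|/andP[dx yx]] w; rewrite inE => /orP[/eqP ->|wh] w0.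
- apply: dug_cons; have /orP[/eqP e|c] := supported_head sh x0.
    by rewrite yx e eqxx in w0.
  by apply: sh => //; rewrite -has_pred1 has_count yx (leq_trans _ c).
- exact/dug_cons/sh.
- by rewrite (par_children lfT yx); exact: dug_cons.
- exact/dug_cons/sh.
Qed.

Lemma children_root_gt0 : 0 < (size (children root))%:R :> R.
Proof. by rewrite ltr0n root_has_child. Qed.

Lemma total_weight_gt0 (x : T) : 0 < lam + (size (children x))%:R.
Proof. by rewrite ltr_wpDr. Qed.

Lemma ler_sum_seq (I : eqType) (s : seq I) (F G : I -> R) :
  (forall i, i \in s -> F i <= G i) -> \sum_(i <- s) F i <= \sum_(i <- s) G i.
Proof.
by move=> FG; rewrite big_seq [leRHS]big_seq; apply: ler_sum.
Qed.

Lemma kernel_mono F G h : (forall y, step h y -> F (y :: h) <= G (y :: h)) ->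
  kernel F h <= kernel G h.
Proof.
rewrite /step /kernel; set x := head _ _ => FG.
case: eqP FG => [x0|/eqP x0] FG /=.
  rewrite ler_pM2r ?invr_gt0 ?children_root_gt0 //; apply: ler_sum_seq => y yr.
  by apply: FG; rewrite /dug x0 eqxx /= yr.
have Fp : F (par x :: h) <= G (par x :: h) by apply: FG; rewrite eqxx.
case: ifPn => dx //; rewrite ler_pM2r ?invr_gt0 ?total_weight_gt0 // lerD //.
  by rewrite ler_pM2l.
by apply: ler_sum_seq => y yx; apply: FG; rewrite dx yx orbT.
Qed.

Lemma eq_kernel F G h : (forall y, step h y -> F (y :: h) = G (y :: h)) ->
  kernel F h = kernel G h.
Proof. by move=> FG; apply/eqP; rewrite eq_le !kernel_mono // => y /FG ->. Qed.

Lemma kernel_cst c h : kernel (fun=> c) h = c.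
Proof.
rewrite /kernel; case: ifP => _.
  rewrite big_const_seq count_predT iter_addr_0 -[c *+ _]mulr_natr mulfK //.
  by rewrite gt_eqF // children_root_gt0.
case: ifP => // _.
rewrite big_const_seq count_predT iter_addr_0 -[c *+ _]mulr_natl -mulrDl.
by rewrite mulrAC divff ?mul1r // gt_eqF // total_weight_gt0.
Qed.

Lemma kernelD F G h : kernel (fun k => F k + G k) h = kernel F h + kernel G h.
Proof.
rewrite /kernel; case: ifP => _; first by rewrite big_split mulrDl.
by case: ifP => // _; rewrite big_split /=; ring.
Qed.

Lemma kernelZ c F h : kernel (fun k => c * F k) h = c * kernel F h.
Proof.
rewrite /kernel; case: ifP => _; first by rewrite -mulr_sumr mulrA.
by case: ifP => // _; rewrite -mulr_sumr; ring.
Qed.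

Lemma kernel_sum (I : Type) (s : seq I) (F : I -> seq T -> R) h :
  kernel (fun k => \sum_(i <- s) F i k) h = \sum_(i <- s) kernel (F i) h.
Proof.
elim: s => [|i s IHs].
  rewrite big_nil -[RHS](kernel_cst 0 h); apply: eq_kernel => y _.
  by rewrite big_nil.
rewrite big_cons -IHs -kernelD; apply: eq_kernel => y _; exact: big_cons.
Qed.

(** [P n] is a property that can be maintained for [n] more steps. *)
Lemma submartingale_iter (P : nat -> seq T -> Prop) F :
  (forall n h y, P n.+1 h -> step h y -> P n (y :: h)) ->
  (forall n h, P n.+1 h -> F h <= kernel F h) ->
  forall n h, P n h -> F h <= iter n kernel F h.
Proof.
move=> Pstep Fsub; elim=> [//|n IHn] h Ph /=.
apply: le_trans (Fsub _ _ Ph) _; apply: kernel_mono => y hy.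
by apply: IHn; exact: Pstep hy.
Qed.

Lemma supermartingale_iter (P : seq T -> Prop) F :
  (forall h y, P h -> step h y -> P (y :: h)) ->
  (forall h, P h -> kernel F h <= F h) ->
  forall n h, P h -> iter n kernel F h <= F h.
Proof.
move=> Pstep Fsup; elim=> [//|n IHn] h Ph /=.
apply: le_trans (Fsup _ Ph); apply: kernel_mono => y hy.
by apply: IHn; exact: Pstep hy.
Qed.

Lemma iter_kernel_mono (P : seq T -> Prop) F G :
  (forall h y, P h -> step h y -> P (y :: h)) ->
  (forall h, P h -> F h <= G h) ->
  forall n h, P h -> iter n kernel F h <= iter n kernel G h.
Proof.
move=> Pstep FG; elim=> [|n IHn] h Ph /=; first exact: FG.
by apply: kernel_mono => y hy; apply: IHn; exact: Pstep hy.
Qed.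

Lemma iter_kernelD F G n h :
  iter n kernel (fun k => F k + G k) h = iter n kernel F h + iter n kernel G h.
Proof.
elim: n h => [|n IHn] h //=; rewrite -kernelD; apply: eq_kernel => y _; exact: IHn.
Qed.

Lemma iter_kernel_sum (I : Type) (s : seq I) (F : I -> seq T -> R) n h :
  iter n kernel (fun k => \sum_(i <- s) F i k) h = \sum_(i <- s) iter n kernel (F i) h.
Proof.
elim: n h => [|n IHn] h //=; rewrite -kernel_sum; apply: eq_kernel => y _; exact: IHn.
Qed.

Lemma iter_kernel_cst c n h : iter n kernel (fun=> c) h = c.
Proof.
elim: n h => [|n IHn] h //=; rewrite -[RHS](kernel_cst c h).
by apply: eq_kernel => y _; exact: IHn.
Qed.

(** * Martingales of the digging walk *)

(** Only the first [M] visits to a vertex contribute a factor; the visit that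
completes the digging moves the position instead. *)
Fixpoint digs (f : T -> R) (h : seq T) : R :=
  if h is y :: h' then digs f h' * (if (count_mem y h' < M)%N then f y else 1) else 1.

(** The value 1 is chosen where [rho (par w)] is zero. This concerns the children of
the root, which receive no visit from the root while the martingale runs, and
the branches on which [rho] vanishes, where the position factor is zero already
while the factors of the other branches must stay intact. *)
Definition step_ratio (rho : T -> R) (w : T) : R :=
  if rho (par w) == 0 then 1 else rho w / rho (par w).

(** A walker on a vertex that is not dug counts as standing on the parent, where
it must go next. *)
Definition position (h : seq T) : T :=
  let x := head root h in if dug h x then x else par x.

Definition dig_value (rho : T -> R) (h : seq T) : R :=
  rho (position h) * digs (step_ratio rho) h.

Definition harmonic_at (rho : T -> R) (x : T) :=
  lam * rho (par x) + \sum_(y <- children x) rho y = (lam + (size (children x))%:R) * rho x.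

Variable rho : T -> R.
Hypotheses (rho_root : rho root = 0)
  (rho_dead : forall x y, x != root -> y \in children x -> rho x = 0 -> rho y = 0).

Lemma ratio_root : step_ratio rho root = 1.
Proof. by rewrite /step_ratio par_root rho_root eqxx. Qed.

Lemma digs_dug h y : dug h y -> digs (step_ratio rho) (y :: h) = digs (step_ratio rho) h.
Proof.
move=> /orP[/eqP ->|c] /=; first by rewrite ratio_root; case: ifP; rewrite mulr1.
by rewrite ltnNge (ltnW c) /= mulr1.
Qed.

Lemma dig_value_dug h y : dug h y -> dig_value rho (y :: h) = rho y * digs (step_ratio rho) h.
Proof.
by move=> dy; rewrite /dig_value digs_dug // /position /= dug_cons.
Qed.

(** The three ways to reach a child [y] of a dug vertex [x] give the same value.
If [y] is dug already, or becomes dug, the position moves to [y]; otherwise the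
position stays at [x] and the product receives [rho y / rho x]. *)
Lemma dig_value_step h y : supported h -> head root h != root -> dug h (head root h) ->
  step h y -> dig_value rho (y :: h) = rho y * digs (step_ratio rho) h.
Proof.
move=> sh x0 dx /orP[/andP[_ /eqP ->]|/andP[_ yx]].
  by apply: dig_value_dug; exact: supported_head.
have [dy|] := boolP (dug h y); first exact: dig_value_dug.
rewrite /dug negb_or -leqNgt => /andP[y0 cy].
rewrite /dig_value /position /= {1}/dug (negbTE y0) /= eqxx add1n ltnS.
have [Mc|cM] := leqP M (count_mem y h); first by rewrite mulr1.
rewrite (par_children lfT yx) /step_ratio (par_children lfT yx).
case: eqP => [e|/eqP e]; first by rewrite e (rho_dead x0 yx e) !mul0r.
by field.
Qed.

(** By [dig_value_step] the product over dug vertices factors out, and what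
remains is the harmonicity of [rho] for the biased walk. *)
Lemma kernel_dig_value h : supported h -> head root h != root ->
  (dug h (head root h) -> harmonic_at rho (head root h)) ->
  kernel (dig_value rho) h = dig_value rho h.
Proof.
move=> sh x0 harm; set x := head root h.
rewrite /kernel -/x (negbTE x0); case: ifPn => dx; last first.
  rewrite dig_value_dug ?supported_head // /dig_value /position -/x.
  by rewrite (negbTE dx).
have st y : y \in children x -> step h y by move=> yx; rewrite /step -/x dx yx orbT.
rewrite dig_value_step //; last by rewrite /step -/x x0 eqxx.
rewrite (eq_big_seq (fun y => rho y * digs (step_ratio rho) h)); last first.
  by move=> y yx; apply: dig_value_step => //; exact: st.
rewrite -mulr_suml mulrA -mulrDl (harm dx) /dig_value /position -/x dx.
have S0 : lam + (size (children x))%:R != 0 by rewrite gt_eqF // total_weight_gt0.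
by field.
Qed.

End Histories.

(** * Potentials of paths *)

Section PathPotentials.
Variables (R : realType) (T : rootedTree) (lam : R) (M : nat).
Notation root := (root_vertex T).
Hypotheses (lfT : locally_finite T) (lam_gt0 : 0 < lam).

Definition resistance (n : nat) : R := \sum_(j < n) lam ^+ j.

Lemma resistance0 : resistance 0 = 0.
Proof. by rewrite /resistance big_ord0. Qed.

Lemma resistanceS n : resistance n.+1 = resistance n + lam ^+ n.
Proof. by rewrite /resistance big_ord_recr. Qed.

Lemma resistance1 : resistance 1 = 1.
Proof. by rewrite resistanceS resistance0 add0r expr0. Qed.

Lemma resistance_ge0 n : 0 <= resistance n.
Proof. by apply: sumr_ge0 => i _; rewrite exprn_ge0 // ltW. Qed.

Lemma resistance_gt0 n : (0 < n)%N -> 0 < resistance n.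
Proof.
case: n => // n _; rewrite resistanceS ltr_wpDl ?resistance_ge0 //.
by rewrite exprn_gt0.
Qed.

Lemma resistance_eq0 n : (resistance n == 0) = (n == 0%N).
Proof.
by case: n => [|n]; rewrite ?resistance0 ?eqxx // gt_eqF // resistance_gt0.
Qed.

Lemma ler_resistance m n : (m <= n)%N -> resistance m <= resistance n.
Proof.
move=> /subnKC <-; elim: (n - m)%N => [|k IHk]; first by rewrite addn0.
by rewrite addnS resistanceS (le_trans IHk) // lerDl exprn_ge0 // ltW.
Qed.

(** The voltage of the unit current that flows from [v] to the root along the
path between them; branches hanging off the path carry no current. *)
Definition potential (v x : T) : R := resistance (meet_depth x v).

Lemma potential_ge0 v x : 0 <= potential v x.
Proof. exact: resistance_ge0. Qed.

Lemma potential_root v : potential v root = 0.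
Proof. by rewrite /potential meet_depth_root resistance0. Qed.

Lemma below_child_par (v x y : T) : y \in children x -> below y v -> below x v.
Proof. by move=> /(par_children lfT) <-; exact: below_par_child. Qed.

Lemma potential_child v x y : y \in children x ->
  potential v y = potential v x + (below y v)%:R * lam ^+ depth x.
Proof.
move=> yx; rewrite /potential; have [yv|nyv] := boolP (below y v).
  rewrite !meet_depth_below ?(below_child_par yx) //.
  by rewrite (depth_children lfT yx) resistanceS mul1r.
by rewrite meet_depth_Nbelow // (par_children lfT yx) mul0r addr0.
Qed.

Lemma potential_par v x : x != root ->
  lam * potential v x = lam * potential v (par x) + (below x v)%:R * lam ^+ depth x.
Proof.
move=> x0; have xc : x \in children (par x) by rewrite mem_children // x0 eqxx.
rewrite (potential_child v xc) mulrDr; congr (_ + _).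
by rewrite (depth_children lfT xc) exprS mulrCA.
Qed.

Lemma potential_dead v x y : x != root -> y \in children x ->
  potential v x = 0 -> potential v y = 0.
Proof.
move=> x0 yx; rewrite (potential_child v yx) => e; rewrite e add0r.
case: (boolP (below y v)) => yv; last by rewrite mul0r.
move: e; rewrite /potential meet_depth_below ?(below_child_par yx) // => /eqP.
by rewrite resistance_eq0 depth_eq0 (negbTE x0).
Qed.

Lemma sum_below_children (v x : T) : x != v ->
  \sum_(y <- children x) (below y v)%:R = (below x v)%:R :> R.
Proof.
move=> xv; have [bx|nbx] := boolP (below x v); last first.
  rewrite big_seq big1 // => y yx; case: (boolP (below y v)) => // /(below_child_par yx).
  by rewrite (negbTE nbx).
have [|y0 y0x y0v] := below_children lfT bx; first by rewrite eq_sym.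
rewrite (bigD1_seq y0) ?children_uniq //= y0v big_seq_cond big1 ?addr0 //.
move=> y /andP[yx yy0]; case: (boolP (below y v)) => // yv.
move: yy0; rewrite -(eqP y0v) -(eqP yv).
by rewrite (depth_children lfT yx) (depth_children lfT y0x) eqxx.
Qed.

(** At a vertex of the path other than [v] the current enters through exactly one
child and leaves through the parent; elsewhere the potential is locally
constant. *)
Lemma potential_harmonic v x : x != root -> x != v -> harmonic_at lam (potential v) x.
Proof.
move=> x0 xv; rewrite /harmonic_at.
rewrite (eq_big_seq _ (@potential_child v x)) big_split /=.
rewrite big_const_seq count_predT iter_addr_0 -mulr_suml sum_below_children //.
rewrite mulrDl (potential_par v x0) -[potential v x *+ _]mulr_natl.
by rewrite -[RHS]addrA; congr (_ + _); exact: addrC.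
Qed.

Lemma harmonicD (r1 r2 : T -> R) x : harmonic_at lam r1 x -> harmonic_at lam r2 x ->
  harmonic_at lam (fun y => r1 y + r2 y) x.
Proof.
rewrite /harmonic_at => h1 h2; rewrite big_split /=.
rewrite [RHS]mulrDr -h1 -h2; ring.
Qed.

(** * Dug factors along one and two paths *)

Lemma digsM (f g : T -> R) h : digs M (fun w => f w * g w) h = digs M f h * digs M g h.
Proof.
elim: h => [|y h IHh] /=; first by rewrite mulr1.
by rewrite IHh; case: ifP => _; ring.
Qed.

Lemma eq_digs (f g : T -> R) h : f =1 g -> digs M f h = digs M g h.
Proof. by move=> fg; elim: h => //= y h ->; rewrite fg. Qed.

(** The product over the visits, regrouped by vertices. *)
Lemma digs_prod (f : T -> R) (S : seq T) h : uniq S ->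
  (forall w, w \notin S -> f w = 1) ->
  digs M f h = \prod_(w <- S) f w ^+ minn (count_mem w h) M.
Proof.
move=> uS f1; elim: h => [|y h IHh] /=.
  by rewrite big1 // => w _; rewrite min0n expr0.
rewrite IHh; have [yS|yS] := boolP (y \in S).
  rewrite !(bigD1_seq y) //= eqxx add1n mulrAC; congr (_ * _); last first.
    by apply: eq_bigr => w wy; rewrite eq_sym (negbTE wy) add0n.
  have [c|c] := ltnP (count_mem y h) M.
    by rewrite -exprSr (minn_idPl c).
  by rewrite mulr1 (minn_idPr (leqW c)).
rewrite f1 // if_same mulr1; apply: eq_big_seq => w wS.
by case: eqP yS => [->|//]; rewrite wS.
Qed.

Definition path_factor (u : T) (g : nat -> R) (w : T) : R :=
  if below w u && (1 < depth w)%N then g (depth w) / g (depth w).-1 else 1.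

Lemma digs_path_factor u g h :
  digs M (path_factor u g) h =
  \prod_(1 <= j < depth u) (g j.+1 / g j) ^+ minn (count_mem (anc j.+1 u) h) M.
Proof.
rewrite (@digs_prod _ [seq anc j.+1 u | j <- index_iota 1 (depth u)]).
- rewrite big_map big_nat_cond [RHS]big_nat_cond; apply: eq_bigr => j /andP[/andP[j1 ju] _].
  by rewrite /path_factor below_anc depth_anc (minn_idPl ju) /= ltnS j1.
- rewrite map_inj_in_uniq ?iota_uniq // => i j; rewrite !mem_index_iota => hi hj e.
  by have := congr1 (@depth T) e; rewrite !depth_anc; lia.
- move=> w; rewrite /path_factor; case: ifP => // /andP[wu w1] /mapP no.
  case: no; exists (depth w).-1; last by rewrite prednK ?(eqP wu) //; lia.
  by rewrite mem_index_iota; have := below_depth wu; lia.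
Qed.

(** Along a path, the capped numbers of visits [e j] are [M] up to some depth,
then possibly one intermediate number, then zero. Therefore the product of the
factors telescopes, at a depth that is the same for every function [g]; this
allows the products for different [g] to be compared. *)
Section Telescope.
Variable e : nat -> nat.
Hypotheses (e_le : forall j, (e j <= M)%N)
  (e_full : forall j, (0 < j)%N -> (0 < e j.+1)%N -> e j = M).

Let val (g : nat -> R) n := g 1%N ^+ M * \prod_(1 <= j < n) (g j.+1 / g j) ^+ e j.+1.

Lemma telescope_full g n : (forall j, (0 < j)%N -> 0 < g j) ->
  (0 < n)%N -> (n == 1%N) || (e n == M) -> val g n = g n ^+ M.
Proof.
move=> g0; elim: n => // -[|n] IHn _ /= en; first by rewrite /val big_geq // mulr1.
rewrite /val big_nat_recr //= mulrA (_ : _ * \prod_(_ <= j < _) _ = g n.+1 ^+ M).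
  by rewrite (eqP en) expr_div_n mulrCA mulfV ?mulr1 // expf_neq0 // gt_eqF // g0.
apply: IHn => //; apply/orP; right; apply/eqP.
have := e_le n.+1; case: (posnP M) => [->|M0 _]; first lia.
by apply: e_full => //; rewrite (eqP en).
Qed.

Lemma telescope_frontier n : (0 < n)%N -> exists f k, [/\ (0 < f)%N, (k <= M)%N &
  forall g, (forall j, (0 < j)%N -> 0 < g j) -> val g n = g f ^+ (M - k) * g f.+1 ^+ k].
Proof.
elim: n => // -[|n] IHn _.
  exists 1%N, 0%N; split => // g g0; rewrite /val big_geq //.
  by rewrite subn0 expr0 !mulr1.
have [e0|e0] := posnP (e n.+2).
  have [|f [k [f0 kM fk]]] := IHn; first by [].
  exists f, k; split => // g g0; rewrite -fk // /val big_nat_recr //= e0 expr0.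
  by rewrite mulr1.
exists n.+1, (e n.+2); split => // g g0.
rewrite /val big_nat_recr //= mulrA (_ : _ * \prod_(_ <= j < _) _ = g n.+1 ^+ M).
  rewrite expr_div_n -{1}(subnK (e_le n.+2)) exprD -mulrA; congr (_ * _).
  by rewrite mulrCA mulfV ?mulr1 // expf_neq0 // gt_eqF // g0.
by apply: telescope_full => //; rewrite (e_full _ e0) // eqxx orbT.
Qed.
End Telescope.

Lemma supported_path (u : T) h j : supported M h -> (0 < j)%N -> (j < depth u)%N ->
  (0 < minn (count_mem (anc j.+1 u) h) M)%N -> minn (count_mem (anc j u) h) M = M.
Proof.
move=> sh j0 ju; rewrite leq_min => /andP[c _].
have : dug M h (par (anc j.+1 u)).
  apply: sh; first by rewrite -has_pred1 has_count.
  by rewrite -depth_gt0 depth_anc; lia.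
rewrite par_anc // /dug -depth_eq0 depth_anc => /orP[|]; lia.
Qed.

Let expo (u : T) h j := if (j <= depth u)%N then minn (count_mem (anc j u) h) M else 0%N.

Lemma digs_path_expo u g h : digs M (path_factor u g) h =
  \prod_(1 <= j < depth u) (g j.+1 / g j) ^+ expo u h j.+1.
Proof.
rewrite digs_path_factor big_nat_cond [RHS]big_nat_cond.
by apply: eq_bigr => j /andP[/andP[_ ju] _]; rewrite /expo ju.
Qed.

Lemma expo_le u h j : (expo u h j <= M)%N.
Proof. by rewrite /expo; case: ifP => // _; lia. Qed.

Lemma expo_full u h j : supported M h -> (0 < j)%N -> (0 < expo u h j.+1)%N -> expo u h j = M.
Proof.
move=> sh j0; rewrite /expo; case: ifP => // ju e; rewrite ltnW //.
exact: supported_path e.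
Qed.

(** One may think of [f] as the depth of the last dug vertex on the path to [u] and
of [k] as the number of visits to the next vertex; the product is the same
whether the next vertex has received [M] visits or is dug. *)
Lemma digs_frontier (u : T) h : supported M h -> u != root -> exists f k,
  [/\ (0 < f)%N, (k <= M)%N & forall g, (forall j, (0 < j)%N -> 0 < g j) ->
    g 1%N ^+ M * digs M (path_factor u g) h = g f ^+ (M - k) * g f.+1 ^+ k].
Proof.
move=> sh u0.
have [|f [k [f0 kM fk]]] :=
  telescope_frontier (expo_le u h) (fun j => @expo_full u h j sh) (n := depth u).
  by rewrite depth_gt0.
by exists f, k; split => // g g0; rewrite digs_path_expo fk.
Qed.

Lemma ratio_potential u : step_ratio (potential u) =1 path_factor u resistance.
Proof.
move=> w; rewrite /step_ratio /path_factor.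
have [w1|w1] := leqP (depth w) 1.
  have -> : par w = root by apply: depth0_root; rewrite depth_par; lia.
  by rewrite potential_root eqxx andbF.
have w0 : w != root by rewrite -depth_gt0; lia.
rewrite andbT /potential; case: (boolP (below w u)) => [wu|nwu].
  rewrite !meet_depth_below ?below_par_child // depth_par resistance_eq0.
  by rewrite (gtn_eqF (m := 0)) //; lia.
rewrite (meet_depth_Nbelow nwu); case: eqP => // /eqP r0.
by rewrite divff.
Qed.

Lemma digs_potential_full u h : supported M h -> u != root -> dug M h u ->
  digs M (step_ratio (potential u)) h = resistance (depth u) ^+ M.
Proof.
move=> sh u0; rewrite /dug (negbTE u0) /= => c.
rewrite (eq_digs _ (ratio_potential u)) digs_path_expo.
have := telescope_full (expo_le u h) (fun j => @expo_full u h j sh) resistance_gt0.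
move=> /(_ (depth u)); rewrite resistance1 expr1n mul1r; apply.
  by rewrite depth_gt0.
by rewrite /expo leqnn anc_depth (minn_idPr (ltnW c)) eqxx orbT.
Qed.

Definition potential2 u v x := potential u x + potential v x.

Lemma meet_depth_branch (u v w : T) : below w u -> ~~ below w v ->
  (meet_depth u v < depth w)%N /\ meet_depth w v = meet_depth u v.
Proof.
move=> wu nwv; have d : (meet_depth u v < depth w)%N.
  rewrite ltnNge; apply: contra nwv => d; rewrite /below -{2}(eqP wu).
  by rewrite -(anc_anc v d) -anc_meet anc_anc.
split => //; apply/eqP; rewrite eqn_leq; apply/andP; split.
  apply: leq_trans (meet_depth_ultra w u v); rewrite leq_min leqnn andbT.
  by rewrite (meet_depth_below wu) meet_depth_lel.
rewrite leq_meet_depth ?meet_depth_ler ?(ltnW d) //.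
rewrite -{1}(eqP wu) anc_anc ?(ltnW d) // anc_meet //.
Qed.

(* The common part of the two paths carries two unit currents, a branch one.
   So the growth of [potential2] splits into that of [gc], which is constant
   beyond the meeting depth, and that of [gb], which is constant before. *)
Let gc (u v : T) j := resistance (minn j (meet_depth u v)).
Let gb (u v : T) j := resistance (maxn j (meet_depth u v)) + resistance (meet_depth u v).

Lemma ratio_potential2 u v : (0 < meet_depth u v)%N ->
  step_ratio (potential2 u v) =1
  (fun w => path_factor u (gc u v) w * (path_factor u (gb u v) w * path_factor v (gb u v) w)).
Proof.
move=> m0 w; rewrite /step_ratio /path_factor /potential2.
have [w1|w1] := leqP (depth w) 1.
  have -> : par w = root by apply: depth0_root; rewrite depth_par; lia.
  by rewrite !potential_root addr0 eqxx !andbF !mulr1.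
have w0 : w != root by rewrite -depth_gt0; lia.
have sum_neq0 i j : (0 < i)%N -> resistance i + resistance j != 0.
  by move=> i0; rewrite gt_eqF // ltr_wpDr ?resistance_ge0 ?resistance_gt0.
have branch u' v' : meet_depth u' v' = meet_depth u v -> below w u' -> ~~ below w v' ->
    (potential u' w + potential v' w) / (potential u' (par w) + potential v' (par w)) =
    gb u v (depth w) / gb u v (depth w).-1 /\
    (potential u' (par w) + potential v' (par w) != 0) /\
    (gc u v (depth w) / gc u v (depth w).-1 = 1).
  move=> m' wu nwv; have [d md] := meet_depth_branch wu nwv.
  rewrite m' in d md.
  rewrite /potential -(meet_depth_Nbelow nwv) md.
  rewrite (meet_depth_below wu) (meet_depth_below (below_par_child wu)).
  rewrite depth_par /gb /gc (maxn_idPl (ltnW d)) (_ : maxn (depth w).-1 _ = (depth w).-1); last lia.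
  rewrite (_ : minn (depth w) _ = meet_depth u v); last lia.
  rewrite (_ : minn (depth w).-1 _ = meet_depth u v); last lia.
  split => //; split; first by apply: sum_neq0; lia.
  by rewrite divff // resistance_eq0; lia.
rewrite !andbT; have [wu|nwu] := boolP (below w u); have [wv|nwv] := boolP (below w v).
- have dm : (depth w <= meet_depth u v)%N.
    rewrite leq_meet_depth ?below_depth // (eqP wu); exact/eqP/esym/eqP.
  rewrite /potential !meet_depth_below ?below_par_child // depth_par.
  rewrite (negbTE (sum_neq0 _ _ _)); last lia.
  rewrite /gc /gb (minn_idPl dm) (maxn_idPr dm).
  rewrite (_ : minn (depth w).-1 _ = (depth w).-1); last lia.
  rewrite (_ : maxn (depth w).-1 _ = meet_depth u v); last lia.
  rewrite divff ?sum_neq0 // !mulr1.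
  have r0 : resistance (depth w).-1 != 0 by rewrite resistance_eq0; lia.
  by field; rewrite r0 -mulr2n mulrn_eq0.
- have [b1 [b2 b3]] := branch u v erefl wu nwv.
  by rewrite (negbTE b2) b1 b3 mulr1 mul1r.
- have := branch v u (meet_depthC v u) wv nwu.
  rewrite (addrC (potential v w)) (addrC (potential v (par w))) => -[b1 [b2 b3]].
  by rewrite (negbTE b2) b1 !mul1r.
- rewrite /potential !(@meet_depth_Nbelow _ w) // !mulr1.
  by case: eqP => // /eqP r0; rewrite divff.
Qed.

(** On each branch the resistance [R_j + R_m] of the pair is at least [R_j], which
makes the two telescoped branch products at least those of the single paths.
The base value at the meeting point is [2 R_m] on each branch, to the power [M]:
this is where [4 ^ M] comes from. The common part, counted once instead of
twice, costs at most [R_m ^ M]. *)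
Lemma digs_pair u v h : supported M h -> (0 < meet_depth u v)%N ->
  digs M (step_ratio (potential u)) h * digs M (step_ratio (potential v)) h <=
  4%:R ^+ M * resistance (meet_depth u v) ^+ M * digs M (step_ratio (potential2 u v)) h.
Proof.
move=> sh m0; set m := meet_depth u v.
have u0 : u != root by apply: contraTneq m0 => ->; rewrite meet_depth_root.
have v0 : v != root by apply: contraTneq m0 => ->; rewrite meet_depthC meet_depth_root.
have [f [k [f0 kM fk]]] := digs_frontier sh u0.
have [f' [k' [f'0 k'M f'k]]] := digs_frontier sh v0.
rewrite (eq_digs _ (ratio_potential2 m0)) !digsM !(eq_digs _ (ratio_potential _)).
have gr j : (0 < j)%N -> 0 < resistance j by exact: resistance_gt0.
have gcp j : (0 < j)%N -> 0 < gc u v j by move=> j0; apply: gr; lia.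
have gbp j : (0 < j)%N -> 0 < gb u v j.
  by move=> j0; rewrite ltr_wpDr ?resistance_ge0 ?gr //; lia.
have := fk _ gr; have := f'k _ gr; have := fk _ gcp; have := fk _ gbp; have := f'k _ gbp.
have -> : gc u v 1 = 1 by rewrite /gc (_ : minn _ _ = 1%N) ?resistance1 //; lia.
have -> : gb u v 1 = 2%:R * resistance m.
  by rewrite /gb (_ : maxn _ _ = m) ?mulr_natl ?mulr2n //; lia.
rewrite resistance1 expr1n !mul1r.
move=> eY eX -> -> ->.
set X := digs _ _ _ in eX *; set Y := digs _ _ _ in eY *.
have rm : 0 < resistance m by exact: gr.
(* The factor [resistance m ^+ M] turns each [resistance j] of the path to [u]
   into the product of its common part and its branch part. *)
rewrite -(ler_pM2l (exprn_gt0 M rm)).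
have -> : resistance m ^+ M * (4%:R ^+ M * resistance m ^+ M *
    (gc u v f ^+ (M - k) * gc u v f.+1 ^+ k * (X * Y))) =
    gc u v f ^+ (M - k) * gc u v f.+1 ^+ k * ((2%:R * resistance m) ^+ M * X) *
    ((2%:R * resistance m) ^+ M * Y).
  rewrite (_ : 4%:R = 2%:R * 2%:R :> R) ?exprMn; first ring.
  by rewrite -natrM.
rewrite eX eY mulrA; apply: ler_pM.
- by rewrite !mulr_ge0 // exprn_ge0 // resistance_ge0.
- by rewrite !mulr_ge0 // exprn_ge0 // resistance_ge0.
- have mm j : resistance m * resistance j <= gc u v j * gb u v j.
    rewrite /gc /gb -/m; have [jm|jm] := leqP j m.
      by rewrite mulrC ler_wpM2l ?resistance_ge0 // lerDl resistance_ge0.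
    by rewrite ler_wpM2l ?resistance_ge0 // lerDl resistance_ge0.
  rewrite -{1}(subnK kM) exprD.
  have -> : resistance m ^+ (M - k) * resistance m ^+ k *
    (resistance f ^+ (M - k) * resistance f.+1 ^+ k) =
    (resistance m * resistance f) ^+ (M - k) * (resistance m * resistance f.+1) ^+ k.
    by rewrite !exprMn; ring.
  have -> : gc u v f ^+ (M - k) * gc u v f.+1 ^+ k *
    (gb u v f ^+ (M - k) * gb u v f.+1 ^+ k) =
    (gc u v f * gb u v f) ^+ (M - k) * (gc u v f.+1 * gb u v f.+1) ^+ k.
    by rewrite !exprMn; ring.
  have nn j : 0 <= resistance m * resistance j by rewrite mulr_ge0 ?resistance_ge0.
  have gg j : 0 <= gc u v j * gb u v j by apply: le_trans (nn j) (mm j).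
  by apply: ler_pM; rewrite ?exprn_ge0 // lerXn2r ?nnegrE.
- have mm j : resistance j <= gb u v j.
    rewrite /gb (le_trans (ler_resistance (leq_maxl j m))) // lerDl.
    exact: resistance_ge0.
  have gg j : 0 <= gb u v j by apply: le_trans (resistance_ge0 j) (mm j).
  by apply: ler_pM; rewrite ?exprn_ge0 ?resistance_ge0 // lerXn2r ?nnegrE ?resistance_ge0.
Qed.

Lemma digs_gt0 (f : T -> R) h : (forall w, 0 < f w) -> 0 < digs M f h.
Proof.
by move=> f0; elim: h => //= y h IHh; rewrite mulr_gt0 //; case: ifP.
Qed.

Lemma ratio_gt0 (r : T -> R) w : (forall x, 0 <= r x) -> (r (par w) != 0 -> r w != 0) ->
  0 < step_ratio r w.
Proof.
move=> r0 rn; rewrite /step_ratio; case: eqP => // /eqP p0.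
by rewrite divr_gt0 // lt_def r0 ?rn // p0.
Qed.

Lemma potential_neq0 u w : potential u (par w) != 0 -> potential u w != 0.
Proof.
rewrite /potential !resistance_eq0; have [wu|nwu] := boolP (below w u).
  rewrite !meet_depth_below ?below_par_child // depth_par; lia.
by rewrite (meet_depth_Nbelow nwu).
Qed.

Lemma dig_value_potential_ge0 u h : 0 <= dig_value M (potential u) h.
Proof.
rewrite /dig_value mulr_ge0 ?potential_ge0 // ltW // digs_gt0 // => w.
apply: ratio_gt0; [exact: potential_ge0|exact: potential_neq0].
Qed.

(** Quasi-independence of two branches. The position factor uses that one of the
two meeting depths of [x] with [u] and [v] is at most that of [u] and [v]. *)
Lemma dig_value_pair u v h : supported M h ->
  dig_value M (potential u) h * dig_value M (potential v) h <=
  4%:R ^+ M * resistance (meet_depth u v) ^+ M.+1 * dig_value M (potential2 u v) h.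
Proof.
move=> sh; rewrite /dig_value; set x := position M h.
have [m0|m0] := posnP (meet_depth u v).
  have := meet_depth_ultra x u v; rewrite m0 resistance0 exprS mul0r mulr0 mul0r.
  rewrite leqn0 /minn; case: ifP => _ /eqP e.
    by rewrite {1}/potential e resistance0 !mul0r.
  by rewrite mulrC {1}/potential e resistance0 !mul0r.
have r2 : potential u x * potential v x <= resistance (meet_depth u v) * potential2 u v x.
  have := meet_depth_ultra x u v; rewrite /potential2 /potential mulrDr.
  have p i j : 0 <= resistance i * resistance j by rewrite mulr_ge0 ?resistance_ge0.
  rewrite geq_min => /orP[] d.
    by rewrite (le_trans (y := resistance (meet_depth u v) * resistance (meet_depth x v)))
      ?ler_wpM2r ?resistance_ge0 ?ler_resistance // lerDr.
  by rewrite mulrC (le_trans (y := resistance (meet_depth u v) * resistance (meet_depth x u)))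
      ?ler_wpM2r ?resistance_ge0 ?ler_resistance // lerDl.
rewrite mulrACA exprS.
have -> : 4 ^+ M * (resistance (meet_depth u v) * resistance (meet_depth u v) ^+ M) *
  (potential2 u v x * digs M (step_ratio (potential2 u v)) h) =
  (resistance (meet_depth u v) * potential2 u v x) *
  (4%:R ^+ M * resistance (meet_depth u v) ^+ M * digs M (step_ratio (potential2 u v)) h) by ring.
apply: ler_pM => //.
- by rewrite mulr_ge0 ?potential_ge0.
- by rewrite mulr_ge0 // ltW // digs_gt0 // => w; apply: ratio_gt0;
    [exact: potential_ge0|exact: potential_neq0|exact: potential_ge0|exact: potential_neq0].
exact: digs_pair.
Qed.

End PathPotentials.

(** * The return time in terms of histories *)

Section Trajectories.
Variables (T : rootedTree) (M : nat).
Notation root := (root_vertex T).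
Notation mdig := (constant_digging T M).

Fixpoint history (x : nat -> T) (n : nat) : seq T :=
  if n is n'.+1 then x n :: history x n' else [:: x 0%N].

Lemma head_history x n : head root (history x n) = x n.
Proof. by case: n. Qed.

Lemma root_history x n : x 0%N = root -> root \in history x n.
Proof. by move=> x0; elim: n => [|n IHn] /=; rewrite inE ?x0 ?eqxx // IHn orbT. Qed.

Lemma local_time_history (x : nat -> T) n v : local_time x n v = count_mem v (history x n).
Proof.
rewrite /local_time -sum1_card big_mkcond /=.
elim: n => [|n IHn]; first by rewrite big_ord_recl big_ord0 /= !addn0 unfold_in /=; case: (x _ == v).
rewrite big_ord_recr /= IHn addnC; congr (_ + _)%N.
Qed.

Lemma started_consE h (y : T) :
  started M (y :: h) = started M h || ((y != root) && (M < count_mem y (y :: h))%N).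
Proof.
apply/idP/idP => [|/orP[|H]]; last 2 first.
- exact: started_cons.
- by apply/hasP; exists y; rewrite ?inE ?eqxx.
case/hasP => w; rewrite inE; case: (eqVneq w y) => [-> _ ->|wy /= wh]; first by rewrite orbT.
move=> H; apply/orP; left; apply/hasP; exists w => //.
by move: H; rewrite /= (negbTE (_ : y != w)) // eq_sym.
Qed.

Lemma started_historyP x n : started M (history x n) <->
  exists s, [/\ (s <= n)%N, x s != root & (M < count_mem (x s) (history x s))%N].
Proof.
elim: n => [|n IHn] /=.
  rewrite started_consE /=; split => [/andP[h1 h2]|[s []]]; first by exists 0%N.
  by rewrite leqn0 => /eqP -> -> ->.
rewrite started_consE; split => [/orP[/IHn[s [sn h1 h2]]|/andP[h1 h2]]|[s [sn h1 h2]]].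
- by exists s; split => //; exact: ltnW.
- by exists n.+1.
- apply/orP; move: sn; rewrite leq_eqVlt => /orP[/eqP e|sn]; last by left; apply/IHn; exists s.
  by right; move: h1 h2; rewrite e => -> ->.
Qed.

Lemma dead_historyP x n : dead M (history x n) <->
  exists t s, [/\ (s < t <= n)%N, x t = root, x s != root & (M < count_mem (x s) (history x s))%N].
Proof.
elim: n => [|n IHn] /=.
  by rewrite andbF; split => // -[t [s [/andP[st t0]]]]; move: t0 st; case: t.
split=> [/orP[/IHn[t [s [/andP[st tn] h1 h2 h3]]]|/andP[/eqP h1 /started_historyP[s [sn h2 h3]]]]|].
- by exists t, s; split; rewrite // st ltnW.
- by exists n.+1, s; split; rewrite // ltnS sn leqnn.
case=> t [s [/andP[st tn] h1 h2 h3]]; apply/orP.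
move: tn; rewrite leq_eqVlt => /orP[/eqP e|tn]; last by left; apply/IHn; exists t, s; rewrite st.
right; rewrite -e h1 eqxx /=; apply/started_historyP; exists s; split => //; lia.
Qed.

Lemma first_time_Some (Q : pred nat) k : first_time Q = Some k -> Q k /\ forall j, Q j -> (k <= j)%N.
Proof.
rewrite /first_time; case: pselect => // exQ [<-].
by case: ex_minnP => m Qm min; split.
Qed.

Lemma first_time_ex (Q : pred nat) k : Q k -> exists2 j, first_time Q = Some j & (j <= k)%N.
Proof.
move=> Qk; rewrite /first_time; case: pselect => [exQ|]; last by case; exists k.
by eexists; first reflexivity; case: ex_minnP => m _; apply.
Qed.

Lemma first_time_None (Q : pred nat) : first_time Q = None <-> forall k, ~ Q k.
Proof.
rewrite /first_time; case: pselect => [exQ|no]; split => //.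
  by move=> H; case: exQ => k Qk; case: (H k).
by move=> _ k Qk; apply: no; exists k.
Qed.

Lemma sigmaS_Some x n t : sigma mdig x n.+1 = Some t -> exists2 s, sigma mdig x n = Some s &
  [&& (s < t)%N, x t != x s & (mdig (x t) + 1 <= local_time x t (x t))%N].
Proof.
move=> /=; case: (sigma _ _ n) => // s ft; have [H _] := first_time_Some ft.
by exists s.
Qed.

Lemma sigma_ge x n t : sigma mdig x n = Some t -> (n <= t)%N.
Proof.
elim: n t => // n IHn t E; have [s /IHn ns /andP[st _]] := sigmaS_Some E.
exact: leq_ltn_trans st.
Qed.

Lemma sigma1_le x n t : sigma mdig x n.+1 = Some t ->
  exists2 s, sigma mdig x 1 = Some s & (s <= t)%N.
Proof.
elim: n t => [|n IHn] t; first by exists t.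
move=> E; have [s /IHn[s' s1 s's] /andP[st _]] := sigmaS_Some E; exists s' => //.
by rewrite (leq_trans s's) // ltnW.
Qed.

(** The root counts as dug from the beginning. So once the walk has stood on
another dug vertex, its next visit to the root is recorded by the extracted
walk, whatever happened in between. *)
Lemma return_time_NoneP x : x 0%N = root ->
  (return_time mdig x = None <-> forall n, ~~ dead M (history x n)).
Proof.
move=> x0; rewrite /return_time first_time_None; split.
  move=> H n; apply/negP => /dead_historyP[t [s [/andP[st _] xt xs cs]]].
  (* [s'] is the last time up to [t] at which the extracted walk moves. *)
  have [k [s' [sk s't kmax]]] : exists k s', [/\ sigma mdig x k = Some s', (s' <= t)%N &
      forall t', sigma mdig x k.+1 = Some t' -> (t < t')%N].
    pose Q k := `[< exists2 s', sigma mdig x k = Some s' & (s' <= t)%N >].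
    have Qex : exists k, Q k by exists 0%N; apply/asboolP; exists 0%N.
    have Qub k : Q k -> (k <= t)%N.
      by move=> /asboolP[s' /sigma_ge]; apply: leq_trans.
    case: (ex_maxnP Qex Qub) => k /asboolP[s' sk s't] kmax.
    exists k, s'; split => // t' st'; rewrite ltnNge; apply/negP => t't.
    suff : (k.+1 <= k)%N by rewrite ltnn.
    by apply: kmax; apply/asboolP; exists t'.
  have next u : (s' < u)%N -> x u != x s' ->
      (mdig (x u) + 1 <= local_time x u (x u))%N -> (t < u)%N.
    move=> su xu lu; pose Q := fun k => [&& (s' < k)%N, x k != x s'
                             & (mdig (x k) + 1 <= local_time x k (x k))%N].
    have [|j jt ju] := @first_time_ex Q u; first by rewrite /Q su xu lu.
    by apply: leq_trans ju; apply: kmax; rewrite /= sk.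
  have [k0|k0] := posnP k.
    move: sk; rewrite k0 => -[s'0]; have s0 : (0 < s)%N.
      by rewrite lt0n; apply: contraNneq xs => ->; rewrite x0.
    suff : (t < s)%N by rewrite ltnNge (ltnW st).
    apply: next; rewrite -?s'0 ?x0 // /constant_digging (negbTE xs).
    by rewrite addn1 local_time_history.
  have xs' : x s' = root.
    apply/eqP; apply/negPn/negP => xs'.
    suff : (t < t)%N by rewrite ltnn.
    apply: next.
    - rewrite ltn_neqAle s't andbT; apply: contraNneq xs' => ->; exact/eqP.
    - by rewrite xt eq_sym.
    - rewrite xt /constant_digging eqxx add0n local_time_history.
      by rewrite -has_count has_pred1 root_history.
  by apply: (H k); rewrite k0 /= /Xtilde sk /= xs' eqxx.
move=> H k /andP[]; case: k => // k _; rewrite /Xtilde.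
case E: (sigma _ _ _) => [t|//] /= /eqP[xt].
have [s s1 st] := sigma1_le E.
have [s0] := sigmaS_Some s1; move=> [<-] /and3P[s_gt0 xs ls].
have xsr : x s != root by rewrite x0 in xs.
move/negP: (H t); apply; apply/dead_historyP; exists t, s; split => //.
- rewrite leqnn andbT ltn_neqAle st andbT.
  by apply: contraNneq xsr => ->; apply/eqP.
- by move: ls; rewrite local_time_history /constant_digging (negbTE xsr) addn1.
Qed.

End Trajectories.

(** * From the law of the walk to the transition operator *)

Section Law.
Context (R : realType) (T : rootedTree) (lam : R) (M : nat).
Context (d : measure_display) (Om : measurableType d) (P : probability Om R).
Context (X : nat -> Om -> T).
Notation root := (root_vertex T).
Notation mdig := (constant_digging T M).
Hypotheses (lfT : locally_finite T) (infT : infinite_tree T) (lam_gt0 : 0 < lam).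
Hypothesis walkX : digging_walk P lam mdig X.

Notation kernel := (kernel lam M).
Notation dug := (dug M).
Notation dead := (dead M).
Notation supported := (supported M).

Definition hist n (w : Om) : seq T := history (X ^~ w) n.

Let Pr (A : set Om) : R := fine (P A).

(** Countability of the tree makes every event about finitely many steps
measurable. *)
Lemma measurable_hist n (phi : pred (seq T)) : measurable [set w | phi (hist n w)].
Proof.
have [mX _ _] := walkX.
elim: n phi => [|n IHn] phi; first exact: (mX 0%N [set v | phi [:: v]]).
rewrite (_ : [set w | _] =
  \bigcup_v (X n.+1 @^-1` [set v] `&` [set w | phi (v :: hist n w)])).
  apply: countable_bigcupT_measurable; first exact: countable_tree.
  by move=> v; apply: measurableI; [exact: mX | exact: (IHn (fun h => phi (v :: h)))].
apply/seteqP; split=> [w /= H|w [v _ /= [<-]]//].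
by exists (X n.+1 w).
Qed.

Lemma le_Pr A B : measurable A -> measurable B -> A `<=` B -> Pr A <= Pr B.
Proof.
move=> mA mB AB; rewrite /Pr fine_le ?fin_num_measure //.
by apply: le_measure; rewrite ?inE.
Qed.

Lemma Pr_ge0 A : 0 <= Pr A.
Proof. by rewrite /Pr fine_ge0. Qed.

Lemma sum_Pr_le (A : set Om) (Y : Om -> T) (s : seq T) : measurable A ->
  (forall B, measurable (Y @^-1` B)) -> uniq s ->
  \sum_(y <- s) Pr (A `&` Y @^-1` [set y]) <= Pr A.
Proof.
move=> mA mY us; have mAY B : measurable (A `&` Y @^-1` B) by apply: measurableI.
suff -> : \sum_(y <- s) Pr (A `&` Y @^-1` [set y]) = Pr (A `&` Y @^-1` [set` s]).
  by apply: le_Pr => // w [].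
elim: s us => [_|y s IHs /= /andP[ys us]].
  by rewrite big_nil (_ : _ `&` _ = set0) ?/Pr ?measure0 //; apply/seteqP; split => w [].
rewrite big_cons IHs // /Pr -fineD ?fin_num_measure // -measureU //.
  congr (fine (P _)); apply/seteqP; split => w /=.
    by case=> -[Aw]; [move=> ->|move=> H]; split => //; rewrite inE ?eqxx // H orbT.
  case=> Aw; rewrite inE => /orP[/eqP|] H; [left|right]; split => //.
apply/seteqP; split => w //= [[_ ->] [_ H]].
by rewrite H in ys.
Qed.

Definition successors (h : seq T) : seq T :=
  let x := head root h in
  if x == root then children root
  else if dug h x then par x :: children x else [:: par x].

Definition step_prob (h : seq T) (y : T) : R :=
  let x := head root h in
  if x == root then (size (children root))%:R^-1
  else if dug h x then (if y == par x then lam else 1) / (lam + (size (children x))%:R)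
  else 1.

Lemma child_neq_par (x y : T) : y \in children x -> (y == par x) = false.
Proof.
move=> yx; apply/negbTE; apply/eqP => e.
by have := depth_children lfT yx; rewrite e depth_par; lia.
Qed.

Lemma kernelE F h : kernel F h = \sum_(y <- successors h) step_prob h y * F (y :: h).
Proof.
rewrite /kernel /successors /step_prob; case: ifP => _.
  by rewrite -mulr_sumr mulrC.
case: ifP => _; last by rewrite big_seq1 mul1r.
rewrite big_cons eqxx mulrDl mulrAC; congr (_ + _).
rewrite mulr_suml; apply: eq_big_seq => y yx.
by rewrite (child_neq_par yx) mulrC mul1r.
Qed.

Lemma successors_uniq h : uniq (successors h).
Proof.
rewrite /successors; case: ifP => _; first exact: children_uniq.
case: ifP => _ //=; rewrite children_uniq andbT.
by apply/negP => /child_neq_par; rewrite eqxx.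
Qed.

Lemma step_successors h y : y \in successors h -> step M h y.
Proof.
rewrite /successors /step; set x := head root h; case: (eqVneq x root) => [x0 /= yx|x0 /=].
  by rewrite x0 yx andbT /dug eqxx.
case: ifPn => dx; last by rewrite inE => ->.
by rewrite inE.
Qed.

Lemma successors_adj h y : y \in successors h -> adj (head root h) y.
Proof.
move=> /step_successors /orP[/andP[x0 /eqP ->]|/andP[_ yx]]; first exact: adj_par.
by rewrite (adj_children lfT) yx orbT.
Qed.

(** The common factor [lam ^ - depth] of the edge weights around a vertex cancels,
and the edges to the children of a vertex that is not dug have weight zero. *)
Lemma weight_ratio (x : nat -> T) n y : x 0%N = root -> supported (history x n) ->
  y \in successors (history x n) ->
  weight lam mdig x n (edge (x n) y) /
    \sum_(u \in [set u : T | adj (x n) u]) weight lam mdig x n (edge (x n) u) =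
  step_prob (history x n) y.
Proof.
move=> x0 sh; set h := history x n; set z := x n.
have hz : head root h = z by exact: head_history.
have zh : z \in h by rewrite /h /z; case: (n) => [|k]; rewrite inE eqxx.
have rh : root \in h by exact: root_history.
have dugE v : v \in h -> (local_time x n v <= mdig v)%N = ~~ dug h v.
  move=> vh; rewrite local_time_history /dug /constant_digging -/h.
  case: eqP => [e|_] /=; last by rewrite leqNgt.
  by apply/negbTE; rewrite -ltnNge -has_count has_pred1.
have wchild u : u \in children z ->
    weight lam mdig x n (edge z u) = (dug h z)%:R * lam ^- depth z.
  move=> uz; rewrite /edge (depth_children lfT uz) ltnSn /weight /= dugE //.
  rewrite /edge_depth /= (depth_children lfT uz); congr (_ * _).
    by case: dug; rewrite ?subr0 ?subrr.
  by rewrite intS opprD addrAC addNr add0r -exprnN.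
have wpar : z != root -> weight lam mdig x n (edge z (par z)) = lam * lam ^- depth z.
  move=> z0; have [_ dz] := parP z0.
  rewrite /edge -dz ltnNge leqnSn /= /weight /= -hz.
  have dp : dug h (par z) by apply: sh.
  have -> : (local_time x n (par (head root h)) <= mdig (par (head root h)))%N = false.
    rewrite hz; case: (eqVneq (par z) root) => [->|p0]; first by rewrite dugE // /dug eqxx.
    apply/negbTE; rewrite local_time_history /constant_digging (negbTE p0) -ltnNge.
    by move: dp; rewrite /dug (negbTE p0).
  rewrite subr0 mul1r /edge_depth /= hz -dz intS opprD addrAC addNr add0r -exprnN.
  by rewrite exprS invfM mulrA divff ?mul1r // gt_eqF.
have L0 : lam ^- depth z != 0 by rewrite invr_neq0 // expf_neq0 // gt_eqF.
have sumE : \sum_(u \in [set u : T | adj z u]) weight lam mdig x n (edge z u) =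
    (if z == root then (size (children root))%:R
     else lam + (dug h z)%:R * (size (children z))%:R) * lam ^- depth z.
  have sumc : \sum_(u <- children z) weight lam mdig x n (edge z u) =
      (dug h z)%:R * (size (children z))%:R * lam ^- depth z.
    rewrite (eq_big_seq _ wchild) big_const_seq count_predT iter_addr_0.
    by rewrite -[LHS]mulr_natr mulrAC.
  case: (eqVneq z root) => [z0|z0].
    rewrite (_ : [set u | _] = [set` children z]).
      by rewrite -fsbig_seq ?children_uniq // sumc z0 /dug eqxx mul1r.
    by apply/seteqP; split => u /=; rewrite (adj_children lfT) z0 eqxx.
  rewrite (_ : [set u | _] = [set` par z :: children z]).
    have us : uniq (par z :: children z).
      by rewrite /= children_uniq andbT; apply/negP => /child_neq_par; rewrite eqxx.
    by rewrite -fsbig_seq // big_cons sumc wpar // mulrDl.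
  by apply/seteqP; split => u /=; rewrite (adj_children lfT) z0 inE.
rewrite sumE /successors /step_prob hz; case: (eqVneq z root) => [z0 yz|z0].
  rewrite wchild ?z0 // /dug eqxx mul1r invfM mulrCA mulfV ?mulr1 //.
  by rewrite -z0.
case: ifPn => dz; last first.
  by rewrite inE => /eqP ->; rewrite wpar // mul0r addr0 divff // mulf_neq0 // gt_eqF.
rewrite mul1r inE => /orP[/eqP ->|yz].
  by rewrite eqxx wpar // -mulf_div divff ?mulr1.
by rewrite (child_neq_par yz) wchild // dz -mulf_div divff ?mulr1.
Qed.

Lemma history_eqP (x x' : nat -> T) n :
  history x n = history x' n <-> forall k, (k <= n)%N -> x k = x' k.
Proof.
elim: n => [|n IHn] /=.
  by split => [[e] k|->//]; rewrite leqn0 => /eqP ->.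
split => [[e /IHn H] k|H].
  by rewrite leq_eqVlt => /orP[/eqP ->//|]; exact: H.
by rewrite H // (IHn.2 _) // => k kn; apply: H; exact: ltnW.
Qed.

Lemma last_history (x : nat -> T) n : last root (history x n) = x 0%N.
Proof. by elim: n => //= n; case: n. Qed.

Let hist_set n h := [set w | hist n w = h].

Lemma measurable_hist_set n h : measurable (hist_set n h).
Proof.
rewrite (_ : hist_set n h = [set w | pred1 h (hist n w)]); first exact: measurable_hist.
by apply/seteqP; split => w /= /eqP.
Qed.

Lemma Pr_step n h y : supported h -> last root h = root -> y \in successors h ->
  Pr (hist_set n h) * step_prob h y <= Pr (hist_set n h `&` X n.+1 @^-1` [set y]).
Proof.
move=> sh lh yh; have [_ _ cX] := walkX.
have [p0|p0] := eqVneq (Pr (hist_set n h)) 0; first by rewrite p0 mul0r Pr_ge0.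
have [w0 hw0] : hist_set n h !=set0.
  by apply/set0P; apply: contraNneq p0 => ->; rewrite /Pr measure0.
pose x := X ^~ w0; have hx : history x n = h by [].
have x0 : x 0%N = root by rewrite -(last_history x n) hx.
have pastE : [set w | forall k, (k <= n)%N -> X k w = x k] = hist_set n h.
  by apply/seteqP; split => w /=; rewrite -hx; move/history_eqP.
have := cX n x y; rewrite /= pastE => /(_ _ _)/esym H.
have xh : x n = head root h by rewrite -hx head_history.
move: H; rewrite weight_ratio ?hx // => ->; last 2 first.
- by apply: contraNneq p0 => e; rewrite /Pr e.
- by rewrite xh; exact: successors_adj.
rewrite /cond_prob -/(Pr _) mulrCA divff // mulr1 setIC.
by apply: le_refl.
Qed.

(** An inequality suffices: it is applied to an event and to its complement, and
the two values of the operator add up to one. *)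
Lemma kernel_le_Pr (phi : pred (seq T)) n k h : supported h -> h != [::] -> last root h = root ->
  Pr (hist_set k h) * iter n kernel (fun g => (phi g)%:R) h <=
  Pr (hist_set k h `&` [set w | phi (hist (n + k) w)]).
Proof.
elim: n k h => [|n IHn] k h sh hn lh /=.
  case: (boolP (phi h)) => ph; last by rewrite mulr0 Pr_ge0.
  rewrite mulr1; apply: le_Pr; first exact: measurable_hist_set.
    by apply: measurableI; [exact: measurable_hist_set|exact: measurable_hist].
  by move=> w /= e; split => //; rewrite add0n e.
have [mX _ _] := walkX.
rewrite kernelE mulr_sumr.
apply: le_trans (sum_Pr_le (Y := X k.+1) (s := successors h) _ _ _); last exact: successors_uniq.
- apply: ler_sum_seq => y yh.
  have st := step_successors yh.
  have lyh : last root (y :: h) = root by case: (h) hn lh.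
  rewrite mulrA; apply: le_trans (_ : Pr (hist_set k.+1 (y :: h)) *
    iter n kernel (fun g => (phi g)%:R) (y :: h) <= _).
    apply: ler_wpM2r.
      rewrite -(iter_kernel_cst M lfT infT lam_gt0 0 n (y :: h)).
      apply: (iter_kernel_mono lfT infT lam_gt0 (P := fun=> True)) => // g _.
    apply: le_trans (Pr_step _ sh lh yh) _.
    apply: le_Pr; last by move=> w [/= <- <-].
      by apply: measurableI; [exact: measurable_hist_set|exact: mX].
    exact: measurable_hist_set.
  apply: le_trans (IHn _ _ (supported_cons lfT sh st) _ lyh) _ => //.
  apply: le_Pr.
  - by apply: measurableI; [exact: measurable_hist_set|exact: measurable_hist].
  - apply: measurableI; last exact: mX.
    by apply: measurableI; [exact: measurable_hist_set|exact: measurable_hist].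
  - by move=> w [/= [e1 e2] H]; split => //; split => //; move: H; rewrite addnS addSn.
- by apply: measurableI; [exact: measurable_hist_set|exact: measurable_hist].
- exact: mX.
Qed.

(** The probability of no return during the first [n] steps. *)
Definition alive_prob n : R := iter n kernel (fun h => (~~ dead h)%:R) [:: root].

Let alive_set n := [set w | X 0%N w = root /\ ~~ dead (hist n w)].

Lemma measurable_alive_set n : measurable (alive_set n).
Proof.
rewrite (_ : alive_set n = [set w | (last root (hist n w) == root) && ~~ dead (hist n w)]).
  exact: (measurable_hist n (fun h => (last root h == root) && ~~ dead h)).
apply/seteqP; split => w /=; rewrite last_history; first by move=> [-> ->]; rewrite eqxx.
by move=> /andP[/eqP].
Qed.

Lemma Pr_start : Pr (hist_set 0 [:: root]) = 1.
Proof.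
have [_ X0 _] := walkX; rewrite /Pr (_ : hist_set _ _ = [set w | X 0%N w = root]) ?X0 //.
by apply/seteqP; split => w /= => [[]//|xr]; rewrite /hist_set /hist /= xr.
Qed.

Lemma Pr_alive_set n : Pr (alive_set n) = alive_prob n.
Proof.
have sr : supported [:: root] by move=> w; rewrite inE => /eqP ->; rewrite eqxx.
have start w : hist_set 0 [:: root] w -> X 0%N w = root by move=> [].
apply/eqP; rewrite eq_le; apply/andP; split; last first.
  have := kernel_le_Pr (fun g => ~~ dead g) n 0 sr isT erefl.
  rewrite Pr_start mul1r => H; apply: le_trans H _; apply: le_Pr.
  - apply: measurableI; first exact: measurable_hist_set.
    exact: (measurable_hist _ (fun g => ~~ dead g)).
  - exact: measurable_alive_set.
  - by move=> w /= [/start ? ]; rewrite addn0.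
have := kernel_le_Pr dead n 0 sr isT erefl; rewrite Pr_start mul1r => H.
have e : iter n kernel (fun g => (dead g)%:R) [:: root] + alive_prob n = 1.
  rewrite /alive_prob -iter_kernelD // -[RHS](iter_kernel_cst M lfT infT lam_gt0 1 n [:: root]).
  congr (iter n kernel _ _); apply/funext => g.
  by case: (dead g); rewrite /= ?addr0 ?add0r.
set B := _ `&` _ in H.
have mB : measurable B.
  by apply: measurableI; [exact: measurable_hist_set|exact: measurable_hist].
have mE := measurable_alive_set n.
have EB : Pr B <= Pr (~` alive_set n).
  apply: le_Pr => //; first exact: measurableC.
  by move=> w [/start _]; rewrite /= addn0 => dw [_]; rewrite dw.
have EC : Pr (~` alive_set n) = 1 - Pr (alive_set n).
  by rewrite /Pr probability_setC // fineB ?fin_num_measure.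
lra.
Qed.

(** Whether [sigma k] equals [t] is decided by time [t]; this is what makes the
return time measurable. *)
Lemma sigma_local (x x' : nat -> T) k t : (forall i, (i <= t)%N -> x i = x' i) ->
  sigma mdig x k = Some t -> sigma mdig x' k = Some t.
Proof.
elim: k t => // k IHk t xx' E.
have [s sk /andP[st H]] := sigmaS_Some E.
have sk' : sigma mdig x' k = Some s.
  by apply: IHk sk => i si; apply: xx'; apply: leq_trans si (ltnW st).
move: E; rewrite /= sk sk'; set Q := (Q in first_time Q) => ft.
have [Qt Qmin] := first_time_Some ft.
set Q' := (Q' in first_time Q').
have QQ' j : (j <= t)%N -> Q' j = Q j.
  move=> jt; rewrite /Q /Q' !local_time_history -!xx' ?(ltnW st) //.
  by rewrite (_ : history x' j = history x j) //; apply/history_eqP => i ij;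
     rewrite xx' // (leq_trans ij).
have [|j fj jt] := @first_time_ex Q' t; first by rewrite QQ'.
rewrite fj; congr Some; apply/eqP; rewrite eqn_leq jt /=.
by apply: Qmin; rewrite -QQ' //; exact: (first_time_Some fj).1.
Qed.

Let return_set := [set w | return_time mdig (X ^~ w) = None].

Lemma measurable_return_set : measurable return_set.
Proof.
have -> : return_set = \bigcap_k \bigcap_t
    ~` [set w | (0 < k)%N /\ sigma mdig (X ^~ w) k = Some t /\ X t w = root].
  apply/seteqP; split=> w /=; rewrite /return_set /= /return_time first_time_None.
    move=> H k _ t _ [k0 [sk xt]]; apply: (H k).
    by rewrite k0 /Xtilde sk /= xt eqxx.
  move=> H k /andP[k0]; rewrite /Xtilde; case E: (sigma _ _ _) => [t|//] /= /eqP[xt].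
  by apply: (H k I t I).
apply: bigcap_measurable; first by exists 0%N.
move=> k _; apply: bigcap_measurable; first by exists 0%N.
move=> t _; apply: measurableC.
pose phi h := `[< exists2 x, history x t = h &
  [/\ (0 < k)%N, sigma mdig x k = Some t & x t = root] >].
rewrite (_ : [set w | _] = [set w | phi (hist t w)]); first exact: measurable_hist.
apply/seteqP; split => w /=.
  by move=> [k0 [sk xt]]; apply/asboolP; exists (X ^~ w).
move=> /asboolP[x /history_eqP xx' [k0 sk xt]]; split => //; split.
  exact: sigma_local sk.
by rewrite -xx'.
Qed.

Lemma return_setE : return_set `&` [set w | X 0%N w = root] = \bigcap_n alive_set n.
Proof.
apply/seteqP; split => w /=.
  move=> [/= H x0] n _; split => //.
  by move: n; apply/(return_time_NoneP M (x := X ^~ w)).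
move=> H; have [x0 _] := H 0%N I; split => //.
by apply/(return_time_NoneP M (x := X ^~ w)) => // n; have [] := H n I.
Qed.

Lemma P_return_set : P return_set = P (\bigcap_n alive_set n).
Proof.
have [mX X0 _] := walkX.
have mB : measurable [set w | X 0%N w = root] := mX 0%N [set root].
rewrite -return_setE -[in LHS](setIT return_set) -(setvU [set w | X 0%N w = root]).
have mA := measurable_return_set.
rewrite setIUr measureU; first last.
- by apply/seteqP; split => w //= [[_ ?] [_ ?]].
- exact: measurableI.
- by apply: measurableI => //; exact: measurableC.
rewrite [X in (X + _)%E](_ : _ = 0%E) ?add0e //.
apply/eqP; rewrite eq_le measure_ge0 andbT.
apply: le_trans (_ : P (~` [set w | X 0%N w = root]) <= _)%E.
  apply: le_measure; rewrite ?inE; last by move=> w [].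
    by apply: measurableI => //; exact: measurableC.
  exact: measurableC.
by rewrite probability_setC // X0 subee.
Qed.

Lemma transient_of_alive_prob c : 0 < c -> (forall n, c <= alive_prob n) ->
  transient P mdig X.
Proof.
move=> c0 calive; rewrite /transient -/return_set P_return_set.
apply: lt_le_trans (_ : c%:E <= _)%E; first by rewrite lte_fin.
have mI : measurable (\bigcap_n alive_set n).
  by apply: bigcap_measurable; [exists 0%N|move=> k _; exact: measurable_alive_set].
have cv : P \o alive_set @ \oo --> P (\bigcap_n alive_set n).
  apply: nonincreasing_cvg_mu => //.
  - by rewrite -ge0_fin_numE // fin_num_measure //; exact: measurable_alive_set.
  - exact: measurable_alive_set.
  - apply/nonincreasing_seqP => n; apply/subsetPset => w /= [x0].
    by rewrite negb_or => /andP[].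
apply: (cvge_to_ge cv); near=> n.
have := calive n; rewrite -Pr_alive_set /Pr -lee_fin fineK // fin_num_measure //.
exact: measurable_alive_set.
Unshelve. all: by end_near. Qed.

Lemma recurrent_of_alive_prob : (forall e, 0 < e -> exists n, alive_prob n <= e) ->
  recurrent P mdig X.
Proof.
move=> small; rewrite /recurrent /transient -/return_set P_return_set => pos.
have mI : measurable (\bigcap_n alive_set n).
  by apply: bigcap_measurable; [exists 0%N|move=> k _; exact: measurable_alive_set].
have pos' : 0 < Pr (\bigcap_n alive_set n).
  by rewrite /Pr fine_gt0 // pos -ge0_fin_numE // fin_num_measure.
have [n] := small _ (divr_gt0 pos' (ltr0n R 2)).
rewrite -Pr_alive_set => H.
have : Pr (\bigcap_n alive_set n) <= Pr (alive_set n).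
  by apply: le_Pr => //; [exact: measurable_alive_set|move=> w /(_ n I)].
move=> /le_trans/(_ H); rewrite ler_pdivlMr // mulr_natr mulr2n.
by rewrite gerDl leNgt pos'.
Qed.

End Law.

(** * Recurrence: upper bounds for the survival probability *)

Section Recurrence.
Variables (R : realType) (T : rootedTree) (lam : R) (M : nat).
Notation root := (root_vertex T).
Hypotheses (lfT : locally_finite T) (infT : infinite_tree T) (lam_gt0 : 0 < lam).

Notation kernel := (kernel lam M).
Notation dug := (dug M).
Notation dead := (dead M).
Notation started := (started M).
Notation supported := (supported M).
Notation step := (step M).
Notation resistance := (resistance lam).
Notation potential := (potential lam).
Notation dig_value := (dig_value M).

Lemma alive_started_head (h : seq T) : started h -> ~~ dead h -> head root h != root.
Proof.
case: h => [|y h]; first by [].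
rewrite started_consE /= negb_or => sh /andP[_ nd]; apply/negP => /eqP y0.
by move: sh nd; rewrite y0 eqxx /= orbF => ->.
Qed.

Lemma started_dug h (v : T) : v != root -> dug h v -> started h.
Proof.
move=> v0; rewrite /dug (negbTE v0) /= => c; apply/hasP; exists v; last by rewrite v0.
by rewrite -has_pred1 has_count (leq_trans _ c).
Qed.

Lemma unstarted_dug h (v : T) : ~~ started h -> dug h v -> v = root.
Proof. by move=> ns dv; apply/eqP; apply: contraNT ns => v0; apply: started_dug dv. Qed.

Lemma unstarted_depth h (w : T) : supported h -> ~~ started h -> w \in h -> (depth w <= 1)%N.
Proof.
move=> sh ns wh; have [->|w0] := eqVneq w root; first by rewrite depth_root.
have := unstarted_dug ns (sh _ wh w0) => /(congr1 (@depth T)).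
by rewrite depth_par depth_root; lia.
Qed.

Lemma unstarted_digs (v : T) h : supported h -> ~~ started h ->
  digs M (step_ratio (potential v)) h = 1.
Proof.
move=> sh ns; rewrite (eq_digs _ _ (ratio_potential lam_gt0 v)).
have : forall w, w \in h -> (depth w <= 1)%N by move=> w; exact: unstarted_depth.
elim: h {sh ns} => //= y h IHh H; rewrite IHh; last first.
  by move=> w wh; apply: H; rewrite inE wh orbT.
by rewrite /path_factor [(1 < _)%N]ltnNge H ?inE ?eqxx // andbF if_same mulr1.
Qed.

Lemma newly_dug h (y v : T) : ~~ dug h v -> dug (y :: h) v -> y = v.
Proof.
rewrite /dug; case: (v == root) => //=; case: (eqVneq y v) => // _.
by rewrite add0n => /negbTE ->.
Qed.

Lemma unstarted_step h (y : T) : supported h -> ~~ started h -> step h y -> y != root ->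
  y \in children root.
Proof.
move=> sh ns /orP[/andP[x0 /eqP ->]|/andP[dx yx] _].
  by move/eqP => []; apply: unstarted_dug ns _; exact: supported_head.
by move: yx; rewrite (unstarted_dug ns dx).
Qed.

(** The martingale of the path to [v], divided by its value when [v] is dug. It is
frozen at 1 from then on, and before the first vertex is dug it is replaced by
the largest value that it can take at that moment. *)
Section ReachBound.
Variable v : T.
Hypothesis v0 : v != root.

Let dig_bound : R := resistance (depth v) ^- M.+1.

Let reach h : R :=
  if dead h then 0 else if dug h v then 1
  else if started h then dig_bound * dig_value (potential v) h else dig_bound.

Let dig_bound_ge0 : 0 <= dig_bound.
Proof. by rewrite invr_ge0 exprn_ge0 // resistance_ge0. Qed.

Let rv : resistance (depth v) != 0.
Proof. by rewrite resistance_eq0 // depth_eq0. Qed.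

Lemma reach_super h : supported h -> kernel reach h <= reach h.
Proof.
move=> sh; have [dh|ah] := boolP (dead h).
  rewrite {2}/reach dh -(kernel_cst M lfT infT lam_gt0 0 h).
  by apply: kernel_mono => // y _; rewrite /reach /= dh.
have [dv|ndv] := boolP (dug h v).
  rewrite {2}/reach dv (negbTE ah) -(kernel_cst M lfT infT lam_gt0 1 h).
  apply: kernel_mono => // y _; rewrite /reach dug_cons //.
  by case: ifP.
rewrite {2}/reach (negbTE ah) (negbTE ndv); case: ifPn => [st|ns].
  have x0 := alive_started_head st ah.
  have dead_pot x y : x != root -> y \in children x -> potential v x = 0 -> potential v y = 0.
    exact: potential_dead.
  rewrite -(@kernel_dig_value _ _ lam M lfT lam_gt0 _ (potential_root lam v) dead_pot h sh x0);
    last first.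
    move=> dx; apply: potential_harmonic => //.
    by apply: contraNneq ndv => <-.
  rewrite -kernelZ; apply: kernel_mono => // y hy; rewrite /reach.
  have nn := dig_value_potential_ge0 M lam_gt0 v (y :: h).
  case: ifP => _; first by rewrite mulr_ge0.
  case: ifPn => [dv|_]; last by rewrite started_cons.
  have yv := newly_dug ndv dv; subst y.
  have pv : position M (v :: h) = v by rewrite /position /= dv.
  rewrite /dig_value pv (digs_potential_full lam_gt0 (supported_cons lfT sh hy) v0 dv).
  by rewrite /potential meet_depth_below ?below_refl // -exprS /dig_bound mulVf // expf_neq0.
rewrite -[leRHS](kernel_cst M lfT infT lam_gt0 dig_bound h).
apply: kernel_mono => // y hy; rewrite /reach.
have r1 z : z \in children root -> resistance (depth z) = 1.
  by move=> zr; rewrite (depth_children lfT zr) depth_root resistance1.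
case: ifP => // _; case: ifPn => [dv|ndv'].
  have yv := newly_dug ndv dv; subst y.
  by rewrite /dig_bound r1 ?expr1n ?invr1 //; exact: unstarted_step hy v0.
case: ifPn => // sty; rewrite ler_piMr //.
have [y0 dy] : y != root /\ dug (y :: h) y.
  move: sty; rewrite started_consE (negbTE ns) /= => /andP[y0 c]; split => //.
  by rewrite /dug /= c orbT.
rewrite /dig_value /position /= dy.
have yr := unstarted_step sh ns hy y0.
rewrite unstarted_digs // mul1r (_ : step_ratio _ _ = 1).
  rewrite if_same mulr1 /potential -(r1 _ yr) ler_resistance //.
  exact: meet_depth_lel.
by rewrite /step_ratio (par_children lfT yr) potential_root eqxx.
Qed.

Lemma reach_bound n :
  iter n kernel (fun h => (~~ dead h && dug h v)%:R) [:: root] <= resistance (depth v) ^- M.+1.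
Proof.
have sr : supported [:: root] by move=> w; rewrite inE => /eqP ->; rewrite eqxx.
have ns : started [:: root] = false by rewrite /started /= eqxx.
apply: le_trans (_ : iter n kernel reach [:: root] <= _).
  apply: (iter_kernel_mono lfT infT lam_gt0 (P := fun=> True)) => // h _.
  rewrite /reach; case: (dead h) => //=; case: (dug h v) => //.
  case: ifP => // _; rewrite mulr_ge0 //; exact: dig_value_potential_ge0.
apply: le_trans (_ : reach [:: root] <= _).
  apply: (supermartingale_iter lfT infT lam_gt0 (P := supported)) => //.
    by move=> h y sh hy; exact: supported_cons.
  exact: reach_super.
rewrite /reach ns /= andbF /dug (negbTE v0) /= eq_sym (negbTE v0) /=.
by [].
Qed.
End ReachBound.

(** As long as the walk stays alive inside a finite set, the function [energy]
decreases by at least 1 per step on average: its first term counts the visits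
still missing to dig the whole set and dominates the steps from the root, its
second term is a function of the depth so concave that the drift is negative
whatever the numbers of children in the set. *)
Section Dwell.
Variable S : seq T.
Hypotheses (uS : uniq S) (childS : {subset children root <= S}).

Let maxd := \max_(x <- S) depth x.
Let maxc := \max_(x <- S) size (children x).
Let c : R := 1 + 2 * maxc%:R / lam.
Let f i : R := \sum_(j < i) c ^+ (maxd - j).

Let c_ge1 : 1 <= c.
Proof. by rewrite /c lerDl divr_ge0 ?mulr_ge0 // ltW. Qed.

Let c_exp k : 1 <= c ^+ k.
Proof. exact: exprn_ege1. Qed.

Let f_ge0 i : 0 <= f i.
Proof. by apply: sumr_ge0 => j _; apply: le_trans (c_exp _). Qed.

Let fS i : f i.+1 = f i + c ^+ (maxd - i).
Proof. by rewrite /f big_ord_recr. Qed.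

Let inS h := ~~ dead h && all (fun w => w \in S) h.

Let undone (h : seq T) : R := \sum_(w <- S) (M.+1 - count_mem w h)%:R.

Let energy h : R :=
  if inS h then (c ^+ maxd + 1) * undone h + f (depth (head root h)) else 0.

Let undone_ge0 h : 0 <= undone h.
Proof. by apply: sumr_ge0. Qed.

Let energy_le h : energy h <= (c ^+ maxd + 1) * undone h + f (depth (head root h)).
Proof.
rewrite /energy; case: ifP => // _; rewrite addr_ge0 // mulr_ge0 // addr_ge0 //.
exact: le_trans (c_exp _).
Qed.

Let energy_ge0 h : 0 <= energy h.
Proof.
rewrite /energy; case: ifP => // _; rewrite addr_ge0 // mulr_ge0 // addr_ge0 //.
exact: le_trans (c_exp _).
Qed.

Let undone_cons y h : undone (y :: h) <= undone h.
Proof. by apply: ler_sum => w _; rewrite ler_nat /= leq_sub2l // leq_addl. Qed.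

Let undone_dig y h : y \in S -> ~~ dug h y -> undone (y :: h) + 1 <= undone h.
Proof.
move=> yS; rewrite /dug negb_or -leqNgt => /andP[_ cy].
rewrite /undone !(bigD1_seq y) //= eqxx addrAC lerD //.
  rewrite natr1 ler_nat add1n subSS subSn //.
by apply: ler_sum => w _; rewrite ler_nat leq_sub2l // leq_addl.
Qed.

Let energy_drift h : supported h -> kernel energy h + (inS h)%:R <= energy h.
Proof.
move=> sh; have [ih|nih] := boolP (inS h); last first.
  rewrite addr0 {2}/energy (negbTE nih) -(kernel_cst M lfT infT lam_gt0 0 h).
  apply: kernel_mono => // y _; rewrite /energy (_ : inS _ = false) //.
  apply: contraNF nih; rewrite /inS /= negb_or => /andP[/andP[-> _] /andP[_]] //.
rewrite -lerBrDr {2}/energy ih; set A := c ^+ maxd + 1.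
have A0 : 0 <= A by rewrite addr_ge0 // (le_trans _ (c_exp _)).
have /andP[ah allh] := ih.
set x := head root h.
have Aun y : A * undone (y :: h) <= A * undone h by rewrite ler_wpM2l.
have [x0|x0] := eqVneq x root.
  have ns : ~~ started h.
    by apply/negP => st; have := alive_started_head st ah; rewrite -/x x0 eqxx.
  rewrite x0 depth_root /f big_ord0 addr0.
  rewrite -(kernel_cst M lfT infT lam_gt0 (A * undone h - 1) h).
  apply: kernel_mono => // y /orP[/andP[]|/andP[_]]; rewrite -/x x0 ?eqxx // => yr.
  apply: le_trans (energy_le _) _ => /=; rewrite (depth_children lfT yr) depth_root.
  rewrite fS /f big_ord0 add0r subn0.
  have : A * (undone (y :: h) + 1) <= A * undone h.
    apply: ler_wpM2l => //; apply: undone_dig; first exact: childS.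
    apply/negP => dy; have := unstarted_dug ns dy.
    by apply/eqP; exact: children_neq_root yr.
  by rewrite mulrDr mulr1 /A; lra.
have xS : x \in S by apply: (allP allh); exact: head_mem.
have dx : (depth x <= maxd)%N by apply: bigop.leq_bigmax_seq.
have cx : (size (children x) <= maxc)%N.
  by apply: (bigop.leq_bigmax_seq (F := fun x => size (children x))).
have [i di] : exists i, depth x = i.+1 by exists (depth x).-1; rewrite prednK // depth_gt0.
have e_par : energy (par x :: h) <= A * undone h + f i.
  apply: le_trans (energy_le _) _ => /=; rewrite depth_par di lerD //.
have e_child y : y \in children x -> energy (y :: h) <= A * undone h + f i.+2.
  by move=> yx; apply: le_trans (energy_le _) _ => /=; rewrite (depth_children lfT yx) di lerD.
rewrite di /kernel -/x (negbTE x0); case: ifPn => dux; last first.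
  apply: le_trans e_par _; rewrite fS.
  by rewrite -!addrA lerD2l lerDl subr_ge0.
set s := size _ in cx *.
have sum_le : \sum_(y <- children x) energy (y :: h) <= s%:R * (A * undone h + f i.+2).
  apply: le_trans (ler_sum_seq e_child) _.
  by rewrite big_const_seq count_predT iter_addr_0 -[_ *+ _]mulr_natl.
rewrite ler_pdivrMr; last by rewrite ltr_wpDr.
apply: le_trans (lerD (_ : _ <= lam * (A * undone h + f i)) sum_le) _.
  by rewrite ler_pM2l.
rewrite !fS (_ : maxd - i = (maxd - i.+1).+1)%N; last by rewrite -di; lia.
set E := c ^+ (maxd - i.+1); rewrite exprS.
have E1 : 1 <= E by exact: c_exp.
have key : (2 * s%:R + lam) * E <= lam * c * E.
  rewrite ler_pM2r; last by apply: lt_le_trans E1.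
  rewrite /c mulrDr mulr1 addrC lerD2l mulrCA mulfV ?mulr1 ?gt_eqF //.
  by rewrite ler_pM2l // ler_nat.
have k2 : 0 <= (s%:R + lam) * (E - 1).
  by rewrite mulr_ge0 ?subr_ge0 // addr_ge0 // ltW.
set U := A * undone h; rewrite -/E; move: key k2; set q := lam * (c * E).
rewrite -(mulrA lam c E) -/q => key k2.
rewrite -subr_ge0.
have -> : (U + (f i + c * E) - 1) * (lam + s%:R) -
  (lam * (U + f i) + s%:R * (U + (f i + c * E + E))) = q - (lam + s%:R) - s%:R * E.
  by rewrite /q; ring.
nra.
Qed.

(* Survival inside [S] is a decreasing event, so its probability at time [n] is at
   most a fraction [1 / n.+1] of the expected time spent there. *)
Let inS_iter n h : supported h -> (n.+1)%:R * iter n kernel (fun g => (inS g)%:R) h <= energy h.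
Proof.
have k0 h' : 0 <= kernel energy h'.
  by rewrite -(kernel_cst M lfT infT lam_gt0 0 h'); apply: kernel_mono.
have mono h' y : (inS (y :: h'))%:R <= (inS h')%:R :> R.
  rewrite ler_nat /inS /= negb_or; case: (dead h') => //=; case: all; rewrite ?andbF //.
  by case: (_ && _).
have le1 m g : iter m kernel (fun g => (inS g)%:R) g <= (inS g)%:R.
  apply: (supermartingale_iter lfT infT lam_gt0 (P := fun=> True)) => // h' _.
  rewrite -[leRHS](kernel_cst M lfT infT lam_gt0 _ h').
  by apply: kernel_mono => // y _; exact: mono.
elim: n h => [|n IHn] h sh /=.
  rewrite mul1r; apply: le_trans (energy_drift sh); by rewrite lerDr.
rewrite -natr1 mulrDl mul1r; apply: le_trans (energy_drift sh); apply: lerD.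
  rewrite -kernelZ; apply: kernel_mono => // y hy; apply: IHn.
  exact: supported_cons hy.
rewrite -[leRHS](kernel_cst M lfT infT lam_gt0 _ h); apply: kernel_mono => // y _.
exact: le_trans (le1 _ _) (mono _ _).
Qed.

Lemma dwell_small e : 0 < e -> exists n,
  iter n kernel (fun h => (~~ dead h && all (fun w => w \in S) h)%:R) [:: root] <= e.
Proof.
move=> e_gt0; have sr : supported [:: root].
  by move=> w; rewrite inE => /eqP ->; rewrite eqxx.
have [n ne] : exists n, energy [:: root] / e <= n%:R.
  exists (Num.bound (energy [:: root] / e)); apply: ltW.
  by apply: archi_boundP; rewrite divr_ge0 // ltW.
exists n; have := inS_iter n sr; set p := iter _ _ _ => H.
have : energy [:: root] <= n.+1%:R * e.
  rewrite -ler_pdivrMr //; apply: le_trans ne _; by rewrite ler_nat.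
by move=> /(le_trans H); rewrite ler_pM2l.
Qed.
End Dwell.

(** [S] contains the component of the root and its boundary [bd]; a living history
that leaves [S] has dug a vertex of [bd]. *)
Lemma alive_prob_small :
  (forall e : R, 0 < e -> exists S bd : seq T,
     [/\ uniq S, root \in S, root \notin bd,
       forall x y, x \in S -> x \notin bd -> y \in children x -> y \in S &
       \sum_(v <- bd) resistance (depth v) ^- M.+1 <= e]) ->
  forall e : R, 0 < e -> exists n, alive_prob T lam M n <= e.
Proof.
move=> H e e0; have e20 : 0 < e / 2 by rewrite divr_gt0.
have [S [bd [uS rS rbd cS sumbd]]] := H _ e20.
have cr : {subset children root <= S} by move=> y; exact: cS.
have [n small] := dwell_small uS cr e20.
exists n; rewrite [e]splitr; apply: le_trans (lerD small sumbd).
have sr : supported [:: root] by move=> w; rewrite inE => /eqP ->; rewrite eqxx.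
apply: le_trans (_ : iter n kernel (fun h =>
  (~~ dead h && all (fun w => w \in S) h)%:R +
  \sum_(v <- bd) (~~ dead h && dug h v)%:R) [:: root] <= _); last first.
  rewrite (@iter_kernelD R T lam M lfT infT lam_gt0
    (fun h => (~~ dead h && all (fun w => w \in S) h)%:R)
    (fun h => \sum_(v <- bd) (~~ dead h && dug h v)%:R)).
  rewrite lerD2l.
  rewrite (@iter_kernel_sum R T lam M lfT infT lam_gt0 T bd
    (fun v h => (~~ dead h && dug h v)%:R)). apply: ler_sum_seq => v vbd.
  by apply: reach_bound; apply: contraTneq vbd => ->.
apply: (iter_kernel_mono lfT infT lam_gt0 (P := supported)) => //.
  by move=> h y sh hy; exact: supported_cons.
move=> h sh; have [dh|ah] := boolP (dead h) => /=.
  by rewrite add0r sumr_ge0.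
have [|nall] := boolP (all _ h); first by rewrite lerDl sumr_ge0.
rewrite add0r; have [v vbd dv] : exists2 v, v \in bd & dug h v.
  apply: contrapT => nodug; move/negP: nall; apply; apply/allP.
  (* Every visited vertex has dug ancestors, hence lies in [S] by induction on the
     depth. *)
  suff Hk k : forall w, depth w = k -> (w \in h) || (w == root) -> w \in S.
    by move=> w wh; apply: (Hk (depth w)) => //; rewrite wh.
  elim: k => [|k IHk] w dw wh; first by rewrite (depth0_root dw).
  have w0 : w != root by rewrite -depth_gt0 dw.
  rewrite (negbTE w0) orbF in wh; have dp := sh _ wh w0.
  apply: (cS (par w)).
  - apply: IHk; first by rewrite depth_par dw.
    move: dp; rewrite /dug orbC => /orP[|->]; last by rewrite orbT.
    by move=> c; rewrite -has_pred1 has_count (leq_trans _ c).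
  - by apply/negP => pbd; apply: nodug; exists (par w).
  - by rewrite mem_children // w0 eqxx.
rewrite (big_rem v) //= dv lerDl sumr_ge0 //.
Qed.

End Recurrence.

(** * Recurrence from small cutsets *)

Section Cutsets.
Variables (R : realType) (T : rootedTree) (lam : R) (M : nat).
Notation root := (root_vertex T).
Hypotheses (lfT : locally_finite T) (infT : infinite_tree T) (lam_gt0 : 0 < lam).

Lemma cutset_boundary (pi : set (T * T)) : cutset pi -> exists S bd : seq T,
  [/\ uniq S, root \in S, root \notin bd, uniq bd &
    (forall x y, x \in S -> x \notin bd -> y \in children x -> y \in S) /\
    (forall v, v \in bd -> pi (par v, v))].
Proof.
move=> cpi; have fK := cutset_inside_finite lfT cpi.
pose K : seq T := finmap.enum_fset (fset_set (inside pi)).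
have memK v : (v \in K) = (v \in inside pi) by rewrite /K in_fset_set.
pose S := undup (root :: flatten [seq children v | v <- K]).
have memS v : (v \in S) = (v == root) || (par v \in inside pi).
  rewrite mem_undup inE; have [//|v0 /=] := eqVneq v root.
  apply/flatten_mapP/idP => [[x xK /(par_children lfT) ->]|pv]; first by rewrite -memK.
  by exists (par v); rewrite ?memK // mem_children // v0 eqxx.
exists S, [seq v <- S | v \notin inside pi]; split.
- exact: undup_uniq.
- by rewrite memS eqxx.
- by rewrite mem_filter negb_and negbK mem_set //; exact: inside_root.
- by rewrite filter_uniq // undup_uniq.
split => [x y xS|v].
  rewrite mem_filter xS andbT negbK => xi yx.
  by rewrite memS (par_children lfT yx) xi orbT.
rewrite mem_filter memS => /andP[nv /orP[/eqP v0|pv]].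
  by move: nv; rewrite v0 mem_set //; exact: inside_root.
apply: inside_exit; [|exact: set_mem|by move=> iv; rewrite mem_set in nv].
by apply: contraNneq nv => ->; apply/mem_set; exact: inside_root.
Qed.

Lemma sum_boundary_le (pi : set (T * T)) (bd : seq T) (w : nat -> R) :
  (forall n, 0 <= w n) -> uniq bd -> (forall v, v \in bd -> pi (par v, v)) ->
  ((\sum_(v <- bd) w (depth v))%:E <= \esum_(e in pi) (w (edge_depth e))%:E)%E.
Proof.
move=> w0 ubd bdpi; apply: esum_ge.
exists [set` [seq (par v, v) | v <- bd]].
  split; first exact: finite_seq.
  by move=> e /= /mapP[v vbd ->]; exact: bdpi.
rewrite -fsbig_seq; last by rewrite map_inj_in_uniq // => u v _ _ [].
by rewrite big_map /edge_depth /= -sumEFin.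
Qed.

Lemma alive_prob_small_of_cutsets (w : nat -> R) (C : R) :
  (forall n, 0 <= w n) -> 0 < C ->
  (forall n, (0 < n)%N -> resistance lam n ^- M.+1 <= C * w n) ->
  (ereal_inf [set \esum_(e in pi) (w (edge_depth e))%:E | pi in @cutset T] <= 0)%E ->
  forall e : R, 0 < e -> exists n, alive_prob T lam M n <= e.
Proof.
move=> w0 C0 rw infw; apply: alive_prob_small => // e e0.
have eC : (0 < (e / C)%:E)%E by rewrite lte_fin divr_gt0.
have := le_lt_trans infw eC; move/ereal_inf_lt => [_ [pi cpi <-] sumpi].
have [S [bd [uS rS rbd ubd [cS bdpi]]]] := cutset_boundary cpi.
exists S, bd; split => //.
have := le_lt_trans (sum_boundary_le w0 ubd bdpi) sumpi; rewrite lte_fin => /ltW H.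
apply: le_trans (_ : C * (e / C) <= _); last by rewrite mulrCA divff ?mulr1 ?gt_eqF.
apply: le_trans (_ : C * \sum_(v <- bd) w (depth v) <= _); last by rewrite ler_pM2l.
rewrite mulr_sumr; apply: ler_sum_seq => v vbd; apply: rw.
by rewrite depth_gt0; apply: contraNneq rbd => <-.
Qed.

End Cutsets.

(** * Transience: the second moment method *)

Section Transience.
Variables (R : realType) (T : rootedTree) (lam : R) (M : nat).
Notation root := (root_vertex T).
Hypotheses (lfT : locally_finite T) (infT : infinite_tree T) (lam_gt0 : 0 < lam).

Notation kernel := (kernel lam M).
Notation dug := (dug M).
Notation dead := (dead M).
Notation started := (started M).
Notation supported := (supported M).
Notation step := (step M).
Notation resistance := (resistance lam).
Notation potential := (potential lam).
Notation potential2 := (potential2 lam).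
Notation dig_value := (dig_value M).
Notation alive_prob := (alive_prob T lam M).

Let ndeg : R := (size (children root))%:R.

Let ndeg_gt0 : 0 < ndeg.
Proof. exact: children_root_gt0. Qed.

Lemma alive_prob_noninc n k : alive_prob (n + k) <= alive_prob n.
Proof.
elim: k => [|k IHk]; first by rewrite addn0.
rewrite addnS; apply: le_trans IHk; rewrite /alive_prob iterSr.
apply: (iter_kernel_mono lfT infT lam_gt0 (P := fun=> True)) => // h _.
rewrite -[leRHS](kernel_cst M lfT infT lam_gt0 _ h); apply: kernel_mono => // y _.
by rewrite ler_nat /= negb_or; case: (dead h) => //=; case: (_ && _).
Qed.

(** For [k = M], the shortest history in which the child [c] of the root is dug. *)
Fixpoint zigzag (c : T) k : seq T :=
  if k is k'.+1 then c :: root :: zigzag c k' else [:: c; root].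

Lemma zigzag_count c k : c != root -> count_mem c (zigzag c k) = k.+1.
Proof.
move=> c0; elim: k => [|k IHk] /=; first by rewrite eqxx eq_sym (negbTE c0).
by rewrite IHk eqxx eq_sym (negbTE c0) add0n add1n.
Qed.

Lemma zigzag_mem c k w : w \in zigzag c k -> w = c \/ w = root.
Proof.
elim: k => [|k IHk] /=; rewrite !inE; first by case/orP => /eqP; [left|right].
by case/or3P => [/eqP|/eqP|//]; [left|right].
Qed.

Lemma zigzag_head c k : head root (zigzag c k) = c.
Proof. by case: k. Qed.

Lemma zigzag_supported c k : c \in children root -> supported (zigzag c k).
Proof.
move=> cr w /zigzag_mem[->|->]; last by rewrite eqxx.
by rewrite (par_children lfT cr) /dug eqxx.
Qed.

Lemma zigzag_started c k : c != root -> started (zigzag c k) = (M <= k)%N.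
Proof.
move=> c0; apply/hasP/idP => [[w /zigzag_mem[->|->]]|Mk].
- by rewrite zigzag_count // c0.
- by rewrite eqxx.
- exists c; last by rewrite zigzag_count // c0.
  by case: k {Mk} => [|k]; rewrite inE eqxx.
Qed.

Lemma zigzag_alive c k : c != root -> (k <= M)%N -> ~~ dead (zigzag c k).
Proof.
move=> c0; elim: k => [|k IHk] kM /=; first by rewrite eqxx (negbTE c0).
by rewrite eqxx (negbTE c0) /= orbF zigzag_started // negb_or -ltnNge kM andbT IHk // ltnW.
Qed.

(** Only the steps away from the root are random, with [k + 1] uniform choices
of a child. *)
Lemma zigzag_start (F : seq T -> R) c k : (forall h, 0 <= F h) -> c \in children root ->
  (k <= M)%N -> ndeg ^- k.+1 * F (zigzag c k) <= iter k.*2.+1 kernel F [:: root].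
Proof.
move=> F0 cr; have c0 := children_neq_root lfT cr.
have kroot (G : seq T -> R) h : (forall h, 0 <= G h) ->
    ndeg^-1 * G (c :: root :: h) <= kernel G (root :: h).
  move=> G0; rewrite /kernel /= eqxx mulrC ler_pM2r ?invr_gt0 //.
  by rewrite (bigD1_seq c) ?children_uniq //= lerDl sumr_ge0.
elim: k F F0 => [|k IHk] F F0 kM; first by rewrite expr1 /=; exact: kroot.
have pos : forall h, 0 <= kernel (kernel F) h.
  have k0 (G : seq T -> R) : (forall h, 0 <= G h) -> forall h, 0 <= kernel G h.
    move=> G0 h; rewrite -(kernel_cst M lfT infT lam_gt0 0 h).
    by apply: kernel_mono.
  exact: (k0 _ (k0 _ F0)).
have -> : iter k.+1.*2.+1 kernel F [:: root] = iter k.*2.+1 kernel (kernel (kernel F)) [:: root].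
  by rewrite doubleS !iterSr.
apply: le_trans (IHk _ pos (ltnW kM)).
rewrite exprSr invfM -mulrA ler_pM2l ?invr_gt0 ?exprn_gt0 //.
rewrite {1}/kernel zigzag_head (negbTE c0) /dug (negbTE c0) zigzag_count // ltnNge kM /=.
by rewrite (par_children lfT cr); exact: kroot.
Qed.

Lemma zigzag_value (rho : T -> R) c : rho root = 0 -> c \in children root ->
  dig_value rho (zigzag c M) = rho c.
Proof.
move=> r0 cr; have c0 := children_neq_root lfT cr.
rewrite /dig_value /position zigzag_head /dug zigzag_count // ltnS leqnn orbT.
have rc : step_ratio rho c = 1 by rewrite /step_ratio (par_children lfT cr) r0 eqxx.
rewrite (_ : digs M _ _ = 1) ?mulr1 //.
elim: {2}M => [|k IHk] /=; rewrite rc (ratio_root r0) ?IHk !if_same !mulr1 //.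
Qed.

Section Certificate.
Variables (N : nat) (theta : T -> R) (K0 : R).
Hypotheses (N_gt0 : (0 < N)%N) (theta_ge0 : forall v, 0 <= theta v) (K0_gt0 : 0 < K0).
Hypothesis energy_le : forall u, u \in level T N ->
  \sum_(v <- level T N) theta v * resistance (meet_depth u v) ^+ M.+1 <= K0.

Let G h : R := \sum_(v <- level T N) theta v * dig_value (potential v) h.

Let pair_weight u v : R :=
  theta u * theta v * (4%:R ^+ M * resistance (meet_depth u v) ^+ M.+1).

Let H h : R := \sum_(u <- level T N) \sum_(v <- level T N)
  pair_weight u v * dig_value (potential2 u v) h.

(* [H] starts from at most [B] times the initial value of [G]; the choice
   [a = 1 / B] maximises the resulting lower bound of [2 a G - a ^ 2 H]. *)
Let B : R := 2%:R * 4%:R ^+ M * K0.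

Let B_gt0 : 0 < B.
Proof. by rewrite /B !mulr_gt0 // exprn_gt0. Qed.

Let F h : R := if dead h then 0 else 2%:R * B^-1 * G h + - (B^-1 ^+ 2) * H h.

Let GH h : supported h -> G h ^+ 2 <= H h.
Proof.
move=> sh; rewrite expr2 /G mulr_suml; apply: ler_sum_seq => u _.
rewrite mulr_sumr; apply: ler_sum_seq => v _.
rewrite mulrACA /pair_weight -[leRHS]mulrA ler_wpM2l ?mulr_ge0 //.
exact: dig_value_pair.
Qed.

Let F_le1 h : supported h -> F h <= (~~ dead h)%:R.
Proof.
move=> sh; rewrite /F; case: ifP => _ //=.
have := GH sh; have b0 : 0 <= B^-1 ^+ 2 by exact: sqr_ge0.
move=> /(ler_wpM2l b0) bH; rewrite mulNr.
have : 0 <= (1 - B^-1 * G h) ^+ 2 by exact: sqr_ge0.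
rewrite sqrrB expr1n exprMn mul1r => sq.
have e : 2%:R * B^-1 * G h = (B^-1 * G h) *+ 2 by rewrite -mulrA mulr_natl.
by rewrite e; lra.
Qed.

Let potential2_dead u v x y : x != root -> y \in children x -> potential2 u v x = 0 ->
  potential2 u v y = 0.
Proof.
move=> x0 yx /eqP; rewrite /potential2 paddr_eq0 ?potential_ge0 // => /andP[/eqP a /eqP b].
by rewrite (potential_dead lfT lam_gt0 x0 yx a) (potential_dead lfT lam_gt0 x0 yx b) addr0.
Qed.

Let potential2_root u v : potential2 u v root = 0.
Proof. by rewrite /potential2 !potential_root addr0. Qed.

Let dig_value_root (rho : T -> R) h : rho root = 0 -> dig_value rho (root :: h) = 0.
Proof. by move=> r0; rewrite /dig_value /position /= /dug eqxx /= r0 mul0r. Qed.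

(* During [n] more steps the walk stays strictly above level [N], where the
   potentials are harmonic. *)
Let safe n h := supported h /\
  (dead h \/ (started h /\ (depth (head root h) + n <= N)%N)).

Let safe_step n h y : safe n.+1 h -> step h y -> safe n (y :: h).
Proof.
move=> [sh dsh] hy; split; first exact: supported_cons hy.
case: dsh => [dh|[st dN]]; first by left; rewrite /= dh.
right; split; first exact: started_cons.
case/orP: hy => [/andP[_ /eqP ->]|/andP[_ yx]] /=.
  by rewrite depth_par; lia.
by rewrite (depth_children lfT yx); lia.
Qed.

Let F_sub n h : safe n.+1 h -> F h <= kernel F h.
Proof.
move=> [sh dsh]; have [dh|ah] := boolP (dead h).
  rewrite {1}/F dh -(kernel_cst M lfT infT lam_gt0 0 h).
  by apply: kernel_mono => // y _; rewrite /F /= dh.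
case: dsh => [dh|[st dN]]; first by rewrite dh in ah.
have x0 := alive_started_head st ah.
have xN v : v \in level T N -> head root h != v.
  move=> vN; apply: contraTneq dN => xv; move: vN; rewrite -xv (mem_level lfT) => /eqP ->.
  by rewrite -ltnNge; lia.
rewrite {1}/F (negbTE ah).
have -> : kernel F h = kernel (fun k => 2%:R * B^-1 * G k + - (B^-1 ^+ 2) * H k) h.
  apply: eq_kernel => // y _; rewrite /F /= (negbTE ah) /=.
  case: ifP => // /andP[/eqP -> _]; rewrite /G /H !big1 ?mulr0 ?addr0 //.
    by move=> u _; rewrite big1 // => v _; rewrite dig_value_root ?mulr0.
  by move=> v _; rewrite dig_value_root ?mulr0 // potential_root.
rewrite (@kernelD R T lam M (fun k => 2%:R * B^-1 * G k)
  (fun k => - (B^-1 ^+ 2) * H k)).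
rewrite !kernelZ // /G /H.
rewrite (@kernel_sum R T lam M lfT infT lam_gt0 T (level T N)
  (fun v k => theta v * dig_value (potential v) k)).
rewrite (@kernel_sum R T lam M lfT infT lam_gt0 T (level T N)
  (fun u k => \sum_(v <- level T N) pair_weight u v * dig_value (potential2 u v) k)).
rewrite le_eqVlt; apply/orP; left; apply/eqP; congr (_ * _ + _ * _).
  apply: eq_big_seq => v vN; rewrite kernelZ // kernel_dig_value //.
  - exact: potential_root.
  - by move=> x y; exact: potential_dead.
  - by move=> _; apply: potential_harmonic => //; exact: xN.
apply: eq_big_seq => u uN.
rewrite (@kernel_sum R T lam M lfT infT lam_gt0 T (level T N)
  (fun v k => pair_weight u v * dig_value (potential2 u v) k)).
apply: eq_big_seq => v vN; rewrite kernelZ // kernel_dig_value //.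
- by move=> x y; exact: potential2_dead.
- by move=> _; apply: harmonicD; apply: potential_harmonic => //; exact: xN.
Qed.

Let mass_below c : R := \sum_(v <- level T N) theta v * (below c v)%:R.

Let potential_child_root v c : c \in children root -> potential v c = (below c v)%:R.
Proof.
move=> cr; rewrite (potential_child lam lfT v cr) potential_root depth_root expr0.
by rewrite mulr1 add0r.
Qed.

Let F_start c : c \in children root -> B^-1 * mass_below c <= F (zigzag c M).
Proof.
move=> cr; have c0 := children_neq_root lfT cr; rewrite /F (negbTE (zigzag_alive c0 (leqnn M))).
have -> : G (zigzag c M) = mass_below c.
  apply: eq_bigr => v _; rewrite zigzag_value ?potential_root //.
  by rewrite potential_child_root.
have HB : H (zigzag c M) <= B * mass_below c.
  have half : \sum_(u <- level T N) \sum_(v <- level T N) pair_weight u v * (below c u)%:R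
      <= 4%:R ^+ M * K0 * mass_below c.
    rewrite /mass_below mulr_sumr; apply: ler_sum_seq => u uN.
    rewrite -mulr_suml mulrCA mulrA mulrA; apply: ler_wpM2r => //.
    rewrite -mulrA.
    have -> : \sum_(v <- level T N) pair_weight u v = theta u * (4%:R ^+ M *
        \sum_(v <- level T N) theta v * resistance (meet_depth u v) ^+ M.+1).
      by rewrite !mulr_sumr; apply: eq_bigr => v _; rewrite /pair_weight; ring.
    by rewrite ler_wpM2l // ler_wpM2l ?exprn_ge0 //; exact: energy_le.
  have -> : H (zigzag c M) =
     \sum_(u <- level T N) \sum_(v <- level T N) pair_weight u v * (below c u)%:R +
     \sum_(u <- level T N) \sum_(v <- level T N) pair_weight u v * (below c u)%:R.
    rewrite {2}exchange_big -big_split; apply: eq_bigr => u _ /=.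
    rewrite -big_split; apply: eq_bigr => v _ /=.
    rewrite zigzag_value // /potential2 !potential_child_root // mulrDr; congr (_ + _ * _).
    by rewrite /pair_weight meet_depthC [theta u * _]mulrC.
  by rewrite /B; move: half; set q := \sum_(u <- _) _; lra.
have b2 : 0 <= B^-1 ^+ 2 by exact: sqr_ge0.
have := ler_wpM2l b2 HB.
have -> : B^-1 ^+ 2 * (B * mass_below c) = B^-1 * mass_below c.
  by rewrite expr2 -mulrA (mulrA B^-1 B) mulVf ?mul1r // gt_eqF.
by rewrite mulNr -mulrA; lra.
Qed.

(** The survival probability bounds the contribution of every child [c] of the
root; averaging over [c] recovers the total weight. *)
Lemma alive_prob_certificate n : (n < N)%N ->
  (ndeg ^- M.+1 * B^-1 * \sum_(v <- level T N) theta v) / ndeg <= alive_prob n.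
Proof.
move=> nN; rewrite ler_pdivrMr // mulrC.
have -> : \sum_(v <- level T N) theta v = \sum_(c <- children root) mass_below c.
  rewrite /mass_below exchange_big; apply: eq_big_seq => v vN /=.
  rewrite -mulr_sumr sum_below_children ?below_root ?mulr1 //.
  by apply: contraTneq vN => <-; rewrite (mem_level lfT) depth_root; lia.
rewrite mulrC mulr_sumr.
have -> : alive_prob n * ndeg = \sum_(c <- children root) alive_prob n.
  by rewrite big_const_seq count_predT iter_addr_0 mulr_natr.
apply: ler_sum_seq => c cr; have c0 := children_neq_root lfT cr.
apply: le_trans (alive_prob_noninc n M.*2.+1).
rewrite addnC /alive_prob iterD -mulrA.
have alive_ge0 (h : seq T) : 0 <= iter n kernel (fun g => (~~ dead g)%:R) h.
  rewrite -(iter_kernel_cst M lfT infT lam_gt0 0 n h).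
  by apply: (iter_kernel_mono lfT infT lam_gt0 (P := fun=> True)).
apply: le_trans (zigzag_start alive_ge0 cr (leqnn M)).
rewrite ler_pM2l ?invr_gt0 ?exprn_gt0 //; apply: le_trans (F_start cr) _.
have sz : safe n (zigzag c M).
  split; first exact: zigzag_supported.
  right; rewrite zigzag_started // zigzag_head (depth_children lfT cr) depth_root.
  by split => //; rewrite add1n.
apply: le_trans (_ : iter n kernel F (zigzag c M) <= _).
  exact: (submartingale_iter lfT infT lam_gt0 safe_step F_sub sz).
apply: (iter_kernel_mono lfT infT lam_gt0 (P := supported)); last exact: zigzag_supported.
  by move=> h y sh hy; exact: supported_cons.
exact: F_le1.
Qed.
End Certificate.

Lemma alive_prob_ge (c0 K0 : R) : 0 < c0 -> 0 < K0 ->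
  (forall N, (0 < N)%N -> exists theta : T -> R,
     [/\ forall v, 0 <= theta v, c0 <= \sum_(v <- level T N) theta v &
       forall u, u \in level T N ->
       \sum_(v <- level T N) theta v * resistance (meet_depth u v) ^+ M.+1 <= K0]) ->
  exists2 c : R, 0 < c & forall n, c <= alive_prob n.
Proof.
move=> c0_gt0 K0_gt0 Hth.
exists ((ndeg ^- M.+1 * (2%:R * 4%:R ^+ M * K0)^-1 * c0) / ndeg).
  by rewrite !mulr_gt0 // invr_gt0 ?exprn_gt0 // !mulr_gt0 // exprn_gt0.
move=> n; have [theta [th0 thc thK]] := Hth n.+1 isT.
have := alive_prob_certificate (ltn0Sn n) th0 K0_gt0 thK (ltnSn n); apply: le_trans.
rewrite ler_pM2r ?invr_gt0 // ler_pM2l // mulr_gt0 ?invr_gt0 ?exprn_gt0 //.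
by rewrite !mulr_gt0 // exprn_gt0.
Qed.

End Transience.

(** * Flows of bounded energy *)

Section Flows.
Variables (R : realType) (T : rootedTree).
Notation root := (root_vertex T).
Hypotheses (lfT : locally_finite T).
Variable cap : nat -> R.
Hypothesis cap_ge0 : forall n, 0 <= cap n.

(** The maximal flow through [v] to its descendants [n] levels below, and a
minimal cut that realises it. *)
Fixpoint maxflow n (v : T) : R :=
  if n is n'.+1 then Num.min (cap (depth v)) (\sum_(y <- children v) maxflow n' y)
  else cap (depth v).

Fixpoint mincut n (v : T) : seq T :=
  if n is n'.+1 then
    if cap (depth v) <= \sum_(y <- children v) maxflow n' y then [:: v]
    else flatten [seq mincut n' y | y <- children v]
  else [:: v].

(** Cutting strictly below [v]: no edge ends at the root, so a cut of the whole tree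
has to start from the children of the root. *)
Definition children_cut n v := flatten [seq mincut n y | y <- children v].

Lemma maxflow_ge0 n v : 0 <= maxflow n v.
Proof.
elim: n v => [|n IHn] v //=; rewrite le_min cap_ge0 /=.
by apply: sumr_ge0 => y _.
Qed.

Lemma mincut_sum n v : \sum_(w <- mincut n v) cap (depth w) = maxflow n v.
Proof.
elim: n v => [|n IHn] v /=; first by rewrite big_seq1.
case: leP => _; first by rewrite big_seq1.
by rewrite big_flatten big_map; apply: eq_bigr => y _; rewrite IHn.
Qed.

Lemma mincut_below n v w : w \in mincut n v -> below v w.
Proof.
elim: n v => [|n IHn] v /=; first by rewrite inE => /eqP ->; exact: below_refl.
case: ifP => _; first by rewrite inE => /eqP ->; exact: below_refl.
by case/flatten_mapP => y yv /IHn; exact: below_child_par.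
Qed.

Lemma children_antichain (F : T -> seq T) v :
  (forall y w, w \in F y -> below y w) ->
  (forall y w w', w \in F y -> w' \in F y -> below w w' -> w = w') ->
  forall w w', w \in flatten [seq F y | y <- children v] ->
    w' \in flatten [seq F y | y <- children v] -> below w w' -> w = w'.
Proof.
move=> Fbelow Fanti w w' /flatten_mapP[y yv wy] /flatten_mapP[y' y'v w'y'] ww'.
suff e : y = y' by rewrite -e in w'y'; exact: Fanti wy w'y' ww'.
have yw' := below_trans (Fbelow _ _ wy) ww'; have y'w' := Fbelow _ _ w'y'.
by rewrite -(eqP yw') -(eqP y'w') (depth_children lfT yv) (depth_children lfT y'v).
Qed.

Lemma mincut_antichain n v w w' : w \in mincut n v -> w' \in mincut n v ->
  below w w' -> w = w'.
Proof.
elim: n v w w' => [|n IHn] v w w' /=; first by rewrite !inE => /eqP -> /eqP ->.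
case: ifP => _; first by rewrite !inE => /eqP -> /eqP ->.
by apply: children_antichain => [y u|y u u']; [exact: mincut_below|exact: IHn].
Qed.

Lemma children_cut_antichain n v w w' : w \in children_cut n v ->
  w' \in children_cut n v -> below w w' -> w = w'.
Proof.
by apply: children_antichain => [y u|y u u']; [exact: mincut_below|exact: mincut_antichain].
Qed.

Lemma mincut_ray (r : nat -> T) n i : infinite_path r ->
  exists2 j, (i <= j)%N & r j \in mincut n (r i).
Proof.
move=> rr; elim: n i => [|n IHn] i /=; first by exists i; rewrite ?inE.
case: ifP => _; first by exists i; rewrite ?inE.
have [j ij rj] := IHn i.+1; exists j; first exact: ltnW.
apply/flatten_mapP; exists (r i.+1) => //.
by rewrite mem_children // -depth_gt0 (ray_step _ rr).1 (ray_step _ rr).2 eqxx.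
Qed.

Definition cut_edges n : set (T * T) := [set` [seq (par w, w) | w <- children_cut n root]].

Lemma children_cut_neq_root n w : w \in children_cut n root -> w != root.
Proof.
case/flatten_mapP => y yr /mincut_below /below_depth.
by rewrite (depth_children lfT yr) -depth_gt0; lia.
Qed.

(** A ray meets the cut by [mincut_ray], and only once because no vertex of the cut
is an ancestor of another. *)
Lemma cut_edgesP n : cutset (cut_edges n).
Proof.
split=> [_ /= /mapP[w wc ->]|r rr].
  have [a dw] := parP (children_cut_neq_root wc).
  by split => //=; rewrite adj_sym.
have mem_cut i : (0 < i)%N -> cut_edges n (edge (r i.-1) (r i)) <-> r i \in children_cut n root.
  move=> i0; rewrite ray_edge //; split => [/mapP[w wc [_ ->]]//|ri].
  by apply/mapP; exists (r i) => //; case: i i0 {ri} => // i _; rewrite (ray_step i rr).2.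
have [j j1 rj] := mincut_ray n 1 rr.
have r0 : r 0%N = root by case: rr.
have jc : r j \in children_cut n root.
  apply/flatten_mapP; exists (r 1%N) => //.
  by rewrite mem_children // -depth_gt0 (ray_step _ rr).1 (ray_step _ rr).2 r0 eqxx.
exists j; split; first by split => //; apply/mem_cut.
move=> i [i1 /(mem_cut i i1) ic]; have [_ rinj _] := rr; apply: rinj.
have bel a b : (a <= b)%N -> below (r a) (r b).
  by move=> ab; rewrite /below (ray_step a rr).1 ray_anc.
have [ji|/ltnW ij] := leqP j i.
  by apply: children_cut_antichain jc ic _; exact: bel.
by apply/esym; apply: children_cut_antichain ic jc _; exact: bel.
Qed.

Lemma cut_edges_sum n : (\esum_(e in cut_edges n) (cap (edge_depth e))%:E <=
  (\sum_(y <- children root) maxflow n y)%:E)%E.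
Proof.
have undup_le (s : seq (T * T)) : \sum_(e <- undup s) cap (edge_depth e) <=
    \sum_(e <- s) cap (edge_depth e).
  elim: s => //= e s IHs; rewrite big_cons; case: ifP => _.
    by rewrite (le_trans IHs) // lerDr.
  by rewrite big_cons lerD2l.
rewrite esum_fset; [|exact: finite_seq|by move=> e _; rewrite lee_fin].
set s := [seq (par w, w) | w <- children_cut n root].
rewrite (_ : cut_edges n = [set` undup s]); last first.
  by apply/seteqP; split => e /=; rewrite mem_undup.
rewrite -fsbig_seq ?undup_uniq // sumEFin lee_fin.
apply: le_trans (undup_le _) _; rewrite /s big_map /children_cut big_flatten big_map.
by rewrite le_eqVlt; apply/orP; left; apply/eqP; apply: eq_bigr => y _; rewrite mincut_sum.
Qed.

Section Flow.
Variable N : nat.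

(** The flow received from the parent is shared among the children in proportion
to their maximal flows. *)
Fixpoint flow_at k (w : T) : R :=
  if k is k'.+1 then
    flow_at k' (par w) *
      (maxflow (N - k) w / \sum_(y <- children (par w)) maxflow (N - k) y)
  else \sum_(y <- children root) maxflow (N - 1) y.

Definition flow w := flow_at (depth w) w.

Let out v := \sum_(y <- children v) maxflow (N - (depth v).+1) y.

Lemma flow_root : flow root = out root.
Proof. by rewrite /flow /out depth_root. Qed.

Lemma flow_child v w : w \in children v ->
  flow w = flow v * (maxflow (N - depth w) w / out v).
Proof.
move=> wv; rewrite /flow (depth_children lfT wv) /= (par_children lfT wv) //.
Qed.

Lemma out_ge0 v : 0 <= out v.
Proof. by apply: sumr_ge0 => y _; exact: maxflow_ge0. Qed.

Lemma flow_ge0 w : 0 <= flow w.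
Proof.
suff H k v : 0 <= flow_at k v by exact: H.
elim: k v => [|k IHk] v /=.
  by apply: sumr_ge0 => y _; exact: maxflow_ge0.
rewrite mulr_ge0 // divr_ge0 ?maxflow_ge0 //.
by apply: sumr_ge0 => y _; exact: maxflow_ge0.
Qed.

Lemma flow_le_maxflow v w : w \in children v -> flow v <= out v ->
  flow w <= maxflow (N - depth w) w.
Proof.
move=> wv fo; rewrite (flow_child wv); have [z0|z0] := eqVneq (out v) 0.
  by rewrite z0 invr0 !mulr0 maxflow_ge0.
have op : 0 < out v by rewrite lt_def z0 out_ge0.
by rewrite mulrCA ler_piMr ?maxflow_ge0 // ler_pdivrMr // mul1r.
Qed.

Lemma flow_le_out v : (depth v < N)%N -> flow v <= out v.
Proof.
move dv : (depth v) => k; elim: k v dv => [|k IHk] v dv vN.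
  by rewrite (depth0_root dv) flow_root.
have vc : v \in children (par v) by rewrite mem_children // eqxx andbT -depth_gt0 dv.
have dp : depth (par v) = k by rewrite depth_par dv.
apply: le_trans (flow_le_maxflow vc (IHk _ dp (ltn_trans (ltnSn k) vN))) _.
rewrite dv /out dv (_ : (N - k.+1 = (N - k.+2).+1)%N); last by lia.
by rewrite /= ge_min lexx orbT.
Qed.

Lemma flow_le_cap w : (0 < depth w <= N)%N -> flow w <= cap (depth w).
Proof.
move=> /andP[w0 wN].
have wc : w \in children (par w) by rewrite mem_children // eqxx andbT -depth_gt0.
have fp : flow (par w) <= out (par w) by apply: flow_le_out; rewrite depth_par; lia.
apply: le_trans (flow_le_maxflow wc fp) _.
by case: (N - _)%N => //= n; rewrite ge_min lexx.
Qed.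

Lemma flow_conservation v : (depth v < N)%N -> \sum_(y <- children v) flow y = flow v.
Proof.
move=> vN; rewrite (eq_big_seq _ (@flow_child v)) -mulr_sumr -mulr_suml.
rewrite (_ : \sum_(y <- children v) maxflow (N - depth y) y = out v); last first.
  by apply: eq_big_seq => y yv; rewrite (depth_children lfT yv).
have [z0|z0] := eqVneq (out v) 0; last by rewrite divff ?mulr1.
rewrite z0 mul0r mulr0; apply/esym/eqP; rewrite eq_le flow_ge0 andbT.
by rewrite -z0 flow_le_out.
Qed.

Lemma flow_below w n : (depth w <= n <= N)%N ->
  \sum_(v <- level T n) flow v * (below w v)%:R = flow w.
Proof.
elim: n => [|n IHn] /andP[].
  by rewrite leqn0 => /eqP/depth0_root -> _; rewrite big_seq1 below_refl mulr1.
rewrite leq_eqVlt => /orP[/eqP dw|dw] nN.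
  rewrite (bigD1_seq w) ?level_uniq ?mem_level ?dw //= below_refl mulr1.
  rewrite big_seq_cond big1 ?addr0 // => v /andP[vn vw].
  rewrite (_ : below w v = false) ?mulr0 //; apply: contraNF vw.
  by move: vn; rewrite -[flatten _]/(level T n.+1) mem_level // -dw /below => /eqP <-; rewrite anc_depth.
rewrite /= big_flatten big_map -[RHS]IHn; last by rewrite -ltnS dw ltnW.
apply: eq_big_seq => v; rewrite mem_level // => /eqP vn.
rewrite -flow_conservation ?vn // mulr_suml; apply: eq_big_seq => y yv.
rewrite -(par_children lfT yv) below_par //.
by apply: contraTneq dw => ->; rewrite (depth_children lfT yv) vn ltnn.
Qed.

Lemma flow_level : (0 < N)%N ->
  \sum_(v <- level T N) flow v = \sum_(y <- children root) maxflow (N - 1) y.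
Proof.
move=> N0; have := @flow_below root N; rewrite depth_root leqnn => /(_ isT).
rewrite flow_root /out depth_root => <-.
by apply: eq_bigr => v _; rewrite below_root mulr1.
Qed.

(** Writing [f m] as the sum of its increments up to [m], the increment at depth
[j] is multiplied by the flow through the ancestor of [u] at depth [j], which is
at most [cap j]. *)
Lemma flow_energy (f : nat -> R) u : f 0%N = 0 -> (forall j, f j <= f j.+1) ->
  u \in level T N ->
  \sum_(v <- level T N) flow v * f (meet_depth u v) <=
  \sum_(j < N) (f j.+1 - f j) * cap j.+1.
Proof.
move=> f0 fmono; rewrite mem_level // => /eqP du.
have fE m : (m <= N)%N -> f m = \sum_(j < N) (f j.+1 - f j) * (j < m)%:R.
  move=> mN; rewrite (eq_bigr (fun j : 'I_N => if (j < m)%N then f j.+1 - f j else 0)).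
    rewrite -big_mkcond /= -(big_ord_widen _ (fun j => f j.+1 - f j) mN).
    by rewrite -(big_mkord xpredT (fun j => f j.+1 - f j)) telescope_sumr // f0 subr0.
  by move=> j _; case: ifP; rewrite ?mulr1 ?mulr0.
rewrite (eq_big_seq (fun v => \sum_(j < N) (f j.+1 - f j) * (flow v * (below (anc j.+1 u) v)%:R))).
  rewrite exchange_big /=; apply: ler_sum => j _; rewrite -mulr_sumr.
  apply: ler_wpM2l; first by rewrite subr_ge0.
  have da : depth (anc j.+1 u) = j.+1 by rewrite depth_anc du; have := ltn_ord j; lia.
  rewrite flow_below; last by rewrite da ltn_ord leqnn.
  by rewrite -{2}da flow_le_cap // da ltn_ord.
move=> v; rewrite mem_level // => /eqP dv.
rewrite fE; last by rewrite -du; exact: meet_depth_lel.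
rewrite mulr_sumr; apply: eq_bigr => j _; rewrite mulrCA; congr (_ * (_ * _%:R)).
rewrite leq_meet_depth ?du ?dv ?ltn_ord // /below depth_anc du (minn_idPl _) ?ltn_ord //.
by rewrite eq_sym.
Qed.

End Flow.

Lemma alive_prob_ge_of_cutsets (lam : R) (M : nat) (K0 : R) :
  infinite_tree T -> 0 < lam -> 0 < K0 ->
  (0 < ereal_inf [set \esum_(e in pi) (cap (edge_depth e))%:E | pi in @cutset T])%E ->
  (forall N, \sum_(j < N) (resistance lam j.+1 ^+ M.+1 - resistance lam j ^+ M.+1) * cap j.+1
     <= K0) ->
  exists2 c : R, 0 < c & forall n, c <= alive_prob T lam M n.
Proof.
move=> infT lam_gt0 K0_gt0 inf_gt0 HK.
pose c0 := ereal_inf [set \esum_(e in pi) (cap (edge_depth e))%:E | pi in @cutset T].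
have cut_ge N : (c0 <= (\sum_(y <- children root) maxflow N y)%:E)%E.
  apply: le_trans (cut_edges_sum N); apply: ereal_inf_lbound.
  by exists (cut_edges N) => //; exact: cut_edgesP.
have c0fin : c0 \is a fin_num.
  rewrite ge0_fin_numE; last exact: ltW.
  exact: le_lt_trans (cut_ge 0%N) (ltry _).
apply: (@alive_prob_ge R T lam M lfT infT lam_gt0 (fine c0) K0) => //.
  by rewrite fine_gt0 // inf_gt0 -ge0_fin_numE // ltW.
move=> N N0; exists (flow N); split.
- exact: flow_ge0.
- by rewrite flow_level // -lee_fin fineK.
move=> u uN; apply: le_trans (HK N).
apply: (@flow_energy N (fun j => resistance lam j ^+ M.+1)) => //.
  by rewrite resistance0 expr0n.
move=> j; rewrite lerXn2r ?nnegrE ?resistance_ge0 // ler_resistance //.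
Qed.

End Flows.

(** * Critical exponents *)

Section Numerics.
Variable R : realType.
Implicit Types (lam : R).

Lemma resistance_at1 n : resistance (1 : R) n = n%:R.
Proof.
rewrite /resistance (eq_bigr (fun=> 1)); last by move=> i _; rewrite expr1n.
by rewrite sumr_const card_ord.
Qed.

Lemma resistance_closed lam n : (lam - 1) * resistance lam n = lam ^+ n - 1.
Proof. by rewrite subrX1. Qed.

Lemma expX_sub_le (x y : R) n : 0 <= y -> y <= x ->
  x ^+ n.+1 - y ^+ n.+1 <= (x - y) * (n.+1%:R * x ^+ n).
Proof.
move=> y0 yx; rewrite subrXX ler_wpM2l ?subr_ge0 //.
rewrite (_ : n.+1%:R * x ^+ n = \sum_(i < n.+1) x ^+ n); last first.
  by rewrite sumr_const card_ord mulr_natl.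
apply: ler_sum => i _ /=.
have iN : (i <= n)%N by rewrite -ltnS.
have -> : x ^+ n = x ^+ (n - i) * x ^+ i by rewrite -exprD subnK.
by rewrite ler_wpM2l ?exprn_ge0 ?(le_trans y0) // lerXn2r // nnegrE (le_trans y0).
Qed.

(** Convexity of [x `^ (- e)], obtained from [1 + t <= expR t] and
[ln (1 + t) <= t]. *)
Lemma powRN_step (e : R) n : 0 < e ->
  e * n.+2%:R `^ (- (1 + e)) <= n.+1%:R `^ (- e) - n.+2%:R `^ (- e).
Proof.
move=> e0; set x : R := n.+1%:R; set y : R := n.+2%:R.
have x0 : 0 < x by rewrite ltr0n.
have y0 : 0 < y by rewrite ltr0n.
have yx : y = x + 1 by rewrite /y /x natr1.
rewrite lerBrDr.
have -> : y `^ (- (1 + e)) = y `^ (- e) * y^-1.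
  have yn0 : y != 0 by rewrite gt_eqF.
  rewrite (_ : - (1 + e) = - e - 1); last by ring.
  by rewrite powRD ?yn0 ?implybT // powR_inv1 // ltW.
have -> : x `^ (- e) = y `^ (- e) * expR (e * (ln y - ln x)).
  by rewrite /powR !gt_eqF // -expRD; congr expR; ring.
have key : e * y^-1 + 1 <= expR (e * (ln y - ln x)).
  apply: le_trans (expR_ge1Dx _); rewrite addrC lerD2l ler_pM2l //.
  have : ln (1 + (x / y - 1)) <= x / y - 1.
    by apply: le_ln1Dx; rewrite -subr_gt0 opprK addrNK divr_gt0.
  rewrite addrC subrK ln_div ?posrE // => H.
  have xy : x / y = 1 - y^-1.
    by rewrite (_ : x = y - 1) ?mulrBl ?divff ?gt_eqF ?mul1r // yx addrK.
  by rewrite -lerN2 opprB (le_trans H) // xy addrAC subrr add0r.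
have := ler_wpM2l (powR_ge0 y (- e)) key.
by rewrite mulrDr mulr1 mulrCA.
Qed.

Lemma powRN_sum_le (e : R) n : 0 < e ->
  \sum_(j < n) j.+1%:R `^ (- (1 + e)) <= 1 + e^-1.
Proof.
move=> e0; case: n => [|n]; first by rewrite big_ord0 addr_ge0 // invr_ge0 ltW.
apply: le_trans (_ : 1 + e^-1 * (1 - n.+1%:R `^ (- e)) <= _); last first.
  by rewrite lerD2l ler_piMr ?invr_ge0 ?ltW // gerBl powR_ge0.
elim: n => [|n IHn]; first by rewrite big_ord1 !powR1 subrr mulr0 addr0.
rewrite big_ord_recr /=; apply: le_trans (lerD IHn (lexx _)) _.
rewrite -addrA lerD2l -(ler_pM2l e0) mulrDr !mulrA divff ?gt_eqF // !mul1r.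
by have := powRN_step n e0; lra.
Qed.

Lemma geometric_sum_le (x : R) n : 0 <= x -> x < 1 -> \sum_(j < n) x ^+ j <= (1 - x)^-1.
Proof.
move=> x0 x1; have d0 : 0 < 1 - x by rewrite subr_gt0.
rewrite -[leRHS]mul1r ler_pdivlMr // mulrC.
by rewrite -[1 - x]opprB mulNr -subrX1 opprB gerBl exprn_ge0.
Qed.

(** For [lam = 1] the increments of [n ^ (M + 1)] are of order [n ^ M], so that the
series converges for every [g > M + 1]. *)
Lemma linear_energy_le (M : nat) (g : R) : M%:R + 1 < g -> forall N,
  \sum_(j < N) (resistance 1 j.+1 ^+ M.+1 - resistance 1 j ^+ M.+1) * j.+1%:R `^ (- g)
  <= M.+1%:R * (1 + (g - M.+1%:R)^-1).
Proof.
rewrite natr1 => Mg N; have e0 : 0 < g - M.+1%:R by rewrite subr_gt0.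
apply: le_trans (_ : \sum_(j < N) M.+1%:R * j.+1%:R `^ (- (1 + (g - M.+1%:R))) <= _); last first.
  by rewrite -mulr_sumr ler_wpM2l // powRN_sum_le.
apply: ler_sum => j _; rewrite !resistance_at1.
have -> : j.+1%:R `^ (- (1 + (g - M.+1%:R))) = j.+1%:R ^+ M * j.+1%:R `^ (- g) :> R.
  rewrite -powR_mulrn // -powRD; last by rewrite pnatr_eq0 /= implybT.
  by congr (_ `^ _); rewrite -natr1; ring.
rewrite mulrA ler_wpM2r ?powR_ge0 //.
have := @expX_sub_le j.+1%:R j%:R M (ler0n _ _); rewrite ler_nat leqnSn => /(_ isT).
by rewrite -natr1 addrAC subrr add0r mul1r natr1.
Qed.

Lemma exponential_energy_le (lam : R) (M : nat) (g : R) : 1 < lam -> lam ^+ M.+1 < g -> forall N,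
  \sum_(j < N) (resistance lam j.+1 ^+ M.+1 - resistance lam j ^+ M.+1) * g ^- j.+1
  <= (lam - 1) ^- M.+1 * (1 - lam ^+ M.+1 / g)^-1.
Proof.
move=> l1 lg N; have l0 : 0 < lam by apply: lt_trans l1.
have q0 : 0 < lam ^+ M.+1 by rewrite exprn_gt0.
have g0 : 0 < g by apply: lt_trans lg.
have d0 : 0 < lam - 1 by rewrite subr_gt0.
set x := lam ^+ M.+1 / g.
have x0 : 0 <= x by rewrite divr_ge0 // ltW.
have x1 : x < 1 by rewrite ltr_pdivrMr // mul1r.
apply: le_trans (_ : \sum_(j < N) (lam - 1) ^- M.+1 * x ^+ j <= _); last first.
  by rewrite -mulr_sumr ler_wpM2l ?geometric_sum_le // invr_ge0 exprn_ge0 // ltW.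
apply: ler_sum => j _.
apply: le_trans (_ : (lam - 1) ^- M.+1 * x ^+ j.+1 <= _); last first.
  rewrite ler_wpM2l ?invr_ge0 ?exprn_ge0 ?(ltW d0) // exprS.
  by rewrite ler_piMl ?exprn_ge0 // ltW.
rewrite /x expr_div_n -exprM mulnC exprM mulrA ler_wpM2r ?invr_ge0 ?exprn_ge0 ?(ltW g0) //.
apply: le_trans (_ : resistance lam j.+1 ^+ M.+1 <= _).
  by rewrite gerBl exprn_ge0 // resistance_ge0.
rewrite -exprVn -exprMn lerXn2r ?nnegrE ?resistance_ge0 //.
  by rewrite mulr_ge0 ?invr_ge0 ?exprn_ge0 ?(ltW d0) ?(ltW l0).
rewrite -(ler_pM2l d0) resistance_closed mulVKf ?gt_eqF //.
by rewrite gerBl.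
Qed.

Lemma exponential_resistance_le (lam : R) (M : nat) n : 1 < lam -> (0 < n)%N ->
  resistance lam n ^- M.+1 <= lam ^+ M.+1 * (lam ^+ M.+1) ^- n.
Proof.
move=> l1; case: n => // n _; have l0 : 0 < lam by apply: lt_trans l1.
have r0 : lam ^+ n <= resistance lam n.+1.
  by rewrite resistanceS lerDr resistance_ge0.
rewrite [_ ^+ n.+1]exprS invfM mulVKf ?gt_eqF ?exprn_gt0 //.
rewrite -exprM mulnC exprM lef_pV2 ?posrE ?exprn_gt0 ?resistance_gt0 //.
by rewrite lerXn2r ?nnegrE ?exprn_ge0 ?resistance_ge0 // ltW.
Qed.

End Numerics.

Theorem theorem5 (R : realType) (T : rootedTree) (M : nat) (lam : R)
    (d : measure_display) (Om : measurableType d) (P : probability Om R)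
    (X : nat -> Om -> T) :
  infinite_tree T -> locally_finite T -> 0 < lam ->
  digging_walk P lam (constant_digging T M) X ->
  [/\ lam = 1 ->
        ((br_r T R < (M%:R + 1)%:E)%E ->
           recurrent P (constant_digging T M) X) /\
        (((M%:R + 1)%:E < br_r T R)%E ->
           transient P (constant_digging T M) X),
      1 < lam ->
        ((br T R < (lam ^+ (M + 1))%:E)%E ->
           recurrent P (constant_digging T M) X) /\
        (((lam ^+ (M + 1))%:E < br T R)%E ->
           transient P (constant_digging T M) X)
    & lam < 1 -> transient P (constant_digging T M) X].
Proof.
move=> infT lfT lam_gt0 walkX; rewrite addn1.
have rec w C := @alive_prob_small_of_cutsets R T lam M lfT infT lam_gt0 w C.
have trans_of : (exists2 c : R, 0 < c & forall n, c <= alive_prob T lam M n) ->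
    transient P (constant_digging T M) X.
  by case=> c c0 H; apply: (transient_of_alive_prob lfT infT lam_gt0 walkX c0 H).
have rec_of : (forall e : R, 0 < e -> exists n, alive_prob T lam M n <= e) ->
    recurrent P (constant_digging T M) X.
  exact: (recurrent_of_alive_prob lfT infT lam_gt0 walkX).
have M1_gt0 : 0 < M%:R + 1 :> R by rewrite natr1 ltr0n.
split.
- move=> l1; split => [brlt|brgt].
    apply/rec_of; apply: (rec (fun n => n%:R `^ (- (M%:R + 1))) 1) => //.
    + move=> n n0; rewrite mul1r l1 resistance_at1 natr1 powRN powR_mulrn //.
    + rewrite leNgt; apply/negP => inf_gt0; move: brlt; apply/negP; rewrite -leNgt.
      rewrite /br_r le_max; apply/orP; right; apply: ereal_sup_ubound.
      by exists (M%:R + 1).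
  have : ((M%:R + 1)%:E < ereal_sup [set g%:E | g in [set g : R | (0 < g)%R /\
    (0 < ereal_inf [set \esum_(e in pi) ((edge_depth e)%:R `^ (- g))%:E
                  | pi in @cutset T])%E]])%E.
    move: brgt; rewrite /br_r lt_max => /orP[|//].
    by rewrite lte_fin ltNge (ltW M1_gt0).
  move=> /ereal_sup_gt[_ [g [g0 inf_gt0] <-]]; rewrite lte_fin => Mg.
  apply/trans_of; apply: (@alive_prob_ge_of_cutsets R T lfT (fun n => n%:R `^ (- g)) _ lam M
    (M.+1%:R * (1 + (g - M.+1%:R)^-1))) => //.
  + by rewrite mulr_gt0 // addr_gt0 // invr_gt0 subr_gt0 -natr1.
  + by rewrite l1; exact: linear_energy_le.
- move=> l1; have q0 : 0 < lam ^+ M.+1 by rewrite exprn_gt0.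
  split => [brlt|].
    apply/rec_of; apply: (rec (fun n => (lam ^+ M.+1) ^- n) (lam ^+ M.+1)) => //.
    + by move=> n; rewrite invr_ge0 exprn_ge0 // ltW.
    + by move=> n; exact: exponential_resistance_le.
    + rewrite leNgt; apply/negP => inf_gt0; move: brlt; apply/negP; rewrite -leNgt.
      by apply: ereal_sup_ubound; exists (lam ^+ M.+1).
  move=> /ereal_sup_gt[_ [g [g0 inf_gt0] <-]]; rewrite lte_fin => Mg.
  apply/trans_of; apply: (@alive_prob_ge_of_cutsets R T lfT (fun n => g ^- n) _ lam M
    ((lam - 1) ^- M.+1 * (1 - lam ^+ M.+1 / g)^-1)) => //.
  + by move=> n; rewrite invr_ge0 exprn_ge0 // ltW.
  + rewrite mulr_gt0 // invr_gt0 ?exprn_gt0 ?subr_gt0 //.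
    by rewrite ltr_pdivrMr // mul1r.
  + exact: exponential_energy_le.
- move=> l1; apply/trans_of.
  have d0 : 0 < 1 - lam by rewrite subr_gt0.
  apply: (@alive_prob_ge R T lam M lfT infT lam_gt0 1 ((1 - lam) ^- M.+1)) => //.
    by rewrite invr_gt0 exprn_gt0.
  move=> N _; have [v dv] := level_nonempty lfT N infT.
  have vN : v \in level T N by rewrite mem_level // dv.
  have sum1 (F : T -> R) : \sum_(w <- level T N) (w == v)%:R * F w = F v.
    rewrite (bigD1_seq v) ?level_uniq //= eqxx mul1r big1 ?addr0 //.
    by move=> w /negbTE ->; rewrite mul0r.
  exists (fun w => (w == v)%:R); split => //.
    rewrite (eq_bigr (fun w => (w == v)%:R * 1)) ?sum1 // => w _; exact/esym/mulr1.
  move=> u uN; rewrite sum1 -exprVn lerXn2r ?nnegrE ?resistance_ge0 ?invr_ge0 ?(ltW d0) //.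
  rewrite -[leRHS]mul1r ler_pdivlMr // mulrC -[1 - lam]opprB mulNr resistance_closed.
  by rewrite opprB gerBl exprn_ge0 // ltW.
Qed.
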